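(* Let $\ell\in\{2,\dots,n\}$, let $G\subset S_n$ be a group of permutations with $\ell$-local base $\mathcal T$, and let $\mu\in\mathcal P(G)$ be a measure of the set $\mathcal M_{\mathcal T}$. (a) Let $d=d_H$ or $d=d_T$, with $W_1$ and $\widetilde T_2$ defined with respect to $d$. For all probability measures $\nu_1$ and $\nu_2$ on $G$, $$\frac{2}{c(\ell)^2}\,W_1^2(\nu_1,\nu_2)\le K_n\left(\sqrt{H(\nu_1|\mu)}+\sqrt{H(\nu_2|\mu)}\right)^2$$ and $$\frac{1}{2c(\ell)^2}\,\widetilde T_2(\nu_2|\nu_1)\le K_n\left(\sqrt{H(\nu_1|\mu)}+\sqrt{H(\nu_2|\mu)}\right)^2,$$ where $c(\ell)=\min(2\ell-1,n)$ if $d=d_H$ and $c(\ell)=2$ if $d=d_T$. When $\mu=\mu_o$ is the uniform law of an $\ell$-local group $G$, these two inequalities hold with $c(\ell)=\ell$ if $d=d_H$ and $c(\ell)=1$ if $d=d_T$. (b) Consider the inequality $$\frac{1}{2c(\ell)^2}\,\overset{\frown}{T}_2(\nu_2|\nu_1)\le\left(\sqrt{H(\nu_1|\mu)}+\sqrt{H(\nu_2|\mu)}\right)^2.\qquad( * )$$ - Assume that $\mu=\mu_o$ is the uniform law of an $\ell$-local group $G$. Then $( * )$ holds for all probability measures $\nu_1,\nu_2$ on $G$ with $c(\ell)^2=2(\ell-1)^2+2$. - Assume that $G$ is a normal subgroup of $S_n$ and that $\mu(\sigma)=\mu(\sigma^{-1})$ and $\mu(\sigma)=\mu(t^{-1}\sigma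 t)$ for all $\sigma\in G$, $t\in S_n$. Then $( * )$ holds for all probability measures $\nu_1,\nu_2$ on $G$ with $c(\ell)^2=8(\ell-1)^2+2$.
   Context: Groups. Let $n\ge2$, $[n]=\{1,\dots,n\}$, and let $S_n$ be the symmetric group on $[n]$, products being compositions: $(\sigma\tau)(i)=\sigma(\tau(i))$. A group of permutations $G$ is a subgroup of $S_n$; $\mathcal P(\cdot)$ denotes the set of probability measures. The support of $\sigma$ is $\mathrm{supp}(\sigma)=\{i\in[n]:\sigma(i)\ne i\}$ and its degree is $\deg(\sigma)=\#\,\mathrm{supp}(\sigma)$. For $\ell\in\{2,\dots,n\}$, $G$ is $\ell$-local if for any $\sigma\in G$ and any $i,j\in[n]$ with $\sigma(i)=j$ there exists $\tau\in G$ such that $\mathrm{supp}(\tau)\subset\mathrm{supp}(\sigma)$, $\deg(\tau)\le\ell$ and $\tau(i)=j$. Local bases. Put $G_n:=G$ and, for $j\in[n-1]$, $G_j:=\{\sigma\in G:\sigma(j+1)=j+1,\dots,\sigma(n)=n\}$. Let $O_j:=\{\sigma(j):\sigma\in G_j\}$ be the orbit of $j$ in $G_j$ (so $\{j\}\subset O_j\subset[j]$). A family $\mathcal T=(t_{i_j,j})$ of elements of $G$, indexed by $j\in\{2,\dots,n\}$ and $i_j\in O_j$, is an $\ell$-local base of $G$ if for every $j$ one has $t_{j,j}=\mathrm{id}$ and for every $i_j\in O_j$ with $i_j\neq j$: $t_{i_j,j}\in G_j$, $t_{i_j,j}(i_j)=j$ and $\deg(t_{i_j,j})\le\ell$. Let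 $U_{\mathcal T}:O_2\times\cdots\times O_n\to G$, $U_{\mathcal T}(i_2,\dots,i_n)=t_{i_2,2}t_{i_3,3}\cdots t_{i_n,n}$. The set $\mathcal M_{\mathcal T}$ consists of all push-forward measures $U_{\mathcal T}\#\hat\nu$ with $\hat\nu=\hat\nu_2\otimes\cdots\otimes\hat\nu_n$, $\hat\nu_j\in\mathcal P(O_j)$ for each $j\in\{2,\dots,n\}$. $\mu_o$ denotes the uniform probability measure on $G$. $K_n$ denotes the cardinality of $\{j\in\{2,\dots,n\}:O_j\ne\{j\}\}$. A subgroup $G$ of $S_n$ is normal if $t^{-1}Gt=G$ for all $t\in S_n$. Distances. $d_H(\sigma,\tau)=\deg(\sigma\tau^{-1})=\sum_{i=1}^n\mathbf 1_{\sigma(i)\ne\tau(i)}$; $d_T(\sigma,\tau)$ is the minimal number $k$ of elements $t_1,\dots,t_k$ of $G$ with degree at most $\ell$ such that $\sigma t_1\cdots t_k=\tau$. Entropy and transport costs. $H(\nu|\mu)=\int\log(d\nu/d\mu)\,d\nu$ if $\nu\ll\mu$ and $+\infty$ otherwise. $\Pi(\nu_1,\nu_2)$ is the set of probability measures on $G\times G$ with first marginal $\nu_1$ and second marginal $\nu_2$. For $\pi\in\Pi(\nu_1,\nu_2)$, $p_\sigma$ denotes probability measures on $G$ such that $\pi(\sigma,\tau)=\nu_1(\sigma)p_\sigma(\tau)$ for all $\sigma,\tau$. Then $$W_1(\nu_1,\nu_2)=\inf_{\pi\in\Pi(\nu_1,\nu_2)}\iint d(\sigma,\tau)\,d\pi(\sigma,\tau),$$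 $$\widetilde T_2(\nu_2|\nu_1)=\inf_{\pi\in\Pi(\nu_1,\nu_2)}\int\Big(\int d(\sigma,\tau)\,dp_\sigma(\tau)\Big)^2d\nu_1(\sigma),$$ $$\overset{\frown}{T}_2(\nu_2|\nu_1)=\inf_{\pi\in\Pi(\nu_1,\nu_2)}\int\sum_{i=1}^n\Big(\int\mathbf 1_{\sigma(i)\ne\tau(i)}\,dp_\sigma(\tau)\Big)^2d\nu_1(\sigma).$$ (Here $\overset{\frown}{T}_2$ is simply the name of this third cost.) *)

(* Defs.v *)
From HB Require Import structures.
From mathcomp Require Import all_boot all_order all_algebra all_fingroup.
From mathcomp Require Import all_classical all_reals all_analysis.

Set Implicit Arguments.
Unset Strict Implicit.
Unset Printing Implicit Defensive.

Import Order.TTheory GRing.Theory Num.Theory.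

Local Open Scope ring_scope.

(* Indices are shifted by one: [n] = {1, ..., n} is represented by
   'I_n = {0, ..., n - 1}, so that j in {2, ..., n} becomes (0 < j)%N. *)

Section Permutations.
Variable n : nat.
Implicit Types (G : {group 'S_n}) (s t : 'S_n) (i j : 'I_n) (l : nat).

(* MathComp composes permutations from left to right, (s * t) i = t (s i);
   products here are compositions of functions. *)
Definition permcomp s t : 'S_n := (t * s)%g.

Lemma permcompE s t i : permcomp s t i = s (t i).
Proof. by rewrite permM. Qed.

Definition psupp s : {set 'I_n} := [set i | s i != i].

Definition pdeg s : nat := #|psupp s|.

Definition local_group l G : Prop :=
  forall s i j, s \in G -> s i = j ->
    exists t, [/\ t \in G, psupp t \subset psupp s, (pdeg t <= l)%N & t i = j].

Definition fixabove G j : {group 'S_n} :=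
  'C_G([set k : 'I_n | (j < k)%N] | 'P)%G.

Definition localorb G j : {set 'I_n} := orbit 'P (fixabove G j) j.

Definition localbase l G (t : 'I_n -> 'I_n -> 'S_n) : Prop :=
  forall j, (0 < j)%N ->
    t j j = 1%g /\
    (forall i, i \in localorb G j -> i != j ->
      [/\ t i j \in fixabove G j, t i j i = j & (pdeg (t i j) <= l)%N]).

(* t_{x_2,2} t_{x_3,3} ... t_{x_n,n}: the big operator runs through 'I_n in
   increasing order *)
Definition Umap (t : 'I_n -> 'I_n -> 'S_n) (x : {ffun 'I_n -> 'I_n}) : 'S_n :=
  \big[permcomp/1%g]_(j < n | (0 < j)%N) t (x j) j.

Definition Kn G : nat :=
  #|[set j : 'I_n | (0 < j)%N && (localorb G j != [set j])]|.

Definition dH s t : nat := pdeg (permcomp s t^-1%g).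

Definition connects l G s t (k : nat) : bool :=
  [exists u : k.-tuple 'S_n,
    all (fun v => (v \in G) && (pdeg v <= l)%N) u && (foldl permcomp s u == t)].

(* The value 0 when s and t are not connected is never used below: see
   [localbase_connects]. *)
Definition dT l G s t : nat :=
  if pselect (exists k, connects l G s t k) is left h then ex_minn h else 0%N.

Lemma dHE s t : dH s t = (\sum_(i < n) (s i != t i))%N.
Proof.
rewrite /dH /pdeg (reindex_inj (@perm_inj _ t^-1%g)) /= -sum1_card big_mkcond.
by apply: eq_bigr => i _; rewrite inE permcompE permKV; case: eqP.
Qed.

Lemma fixaboveP G j s :
  reflect (s \in G /\ forall k : 'I_n, (j < k)%N -> s k = k)
          (s \in fixabove G j).
Proof.
rewrite /fixabove inE; apply: (iffP andP) => -[sG].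
  move/astabP => fixs; split=> // k jk.
  by have /= := fixs k; rewrite inE jk apermE => ->.
move=> fixs; split=> //; apply/astabP => k; rewrite inE => jk.
by rewrite /= apermE fixs.
Qed.

Lemma localorbP G j i :
  reflect (exists2 s, s \in fixabove G j & s j = i) (i \in localorb G j).
Proof. exact: (iffP orbitP) => -[s sG <-]; exists s. Qed.

(* The coordinate of index 0 of an element of [family (localorb G)] carries no
   information. *)
Lemma localorb0 G j : j = 0%N :> nat -> localorb G j = [set j].
Proof.
move=> j0; apply/setP => i; rewrite inE; apply/localorbP/eqP => [[s]|->]; last first.
  by exists 1%g; rewrite ?group1 ?perm1.
case/fixaboveP=> _ fixs <-.
have [//|sjj] := eqVneq (s j) j.
have : (j < s j)%N by rewrite j0 lt0n -j0.
by move/fixs/perm_inj.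
Qed.

Lemma localbase_connects l G fam s t : localbase l G fam ->
  s \in G -> t \in G -> exists k, connects l G s t k.
Proof.
move=> baseP sG tG.
pose P (v : 'S_n) := (v \in G) && (pdeg v <= l)%N.
have gen m : forall v, v \in G -> (forall k : 'I_n, (m <= k)%N -> v k = k) ->
    exists2 u : seq 'S_n, all P u & v = foldl permcomp 1%g u.
  elim: m => [|m IHm] v vG fixv.
    by exists [::] => //=; apply/permP => k; rewrite perm1 fixv.
  have [nm|mn] := leqP n m.
    apply: IHm => // k mk; have := ltn_ord k.
    by rewrite ltnNge (leq_trans nm mk).
  have [m0|m0] := posnP m.
    apply: IHm => // k _; have [k0|k0] := posnP k; last by apply: fixv; rewrite m0.
    apply/val_inj/eqP; rewrite /= k0 -leqn0 leqNgt; apply/negP => vk0.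
    have /perm_inj vk : v (v k) = v k by apply: fixv; rewrite m0.
    by rewrite vk k0 in vk0.
  pose j := Ordinal mn; pose i := v^-1%g j.
  have iO : i \in localorb G j.
    apply/localorbP; exists v^-1%g => //; apply: groupVr.
    by apply/fixaboveP; split.
  have [tjj tij] := baseP j m0.
  have [ij|ij] := eqVneq i j.
    apply: IHm => // k; rewrite leq_eqVlt => /predU1P[mk|]; last exact: fixv.
    have -> : k = j by exact/val_inj.
    by rewrite -[in LHS]ij permKV.
  have [tG' ti tl] := tij _ iO ij.
  case/fixaboveP: tG' => tG' fixt.
  have [|k|u Pu vu] := IHm (permcomp v (fam i j)^-1%g).
  - by rewrite groupM ?groupV.
  - rewrite permcompE leq_eqVlt => /predU1P[mk|mk].
      have -> : k = j by exact/val_inj.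
      have -> : (fam i j)^-1%g j = i.
        by apply: (@perm_inj _ (fam i j)); rewrite permKV.
      by rewrite permKV.
    have -> : (fam i j)^-1%g k = k.
      by apply: (@perm_inj _ (fam i j)); rewrite permKV fixt.
    exact: fixv.
  exists (rcons u (fam i j)); first by rewrite all_rcons /P tG' tl.
  by rewrite -cats1 foldl_cat /= -vu /permcomp mulKVg.
have [|k|u Pu tu] := gen n (permcomp s^-1%g t).
- by rewrite groupM ?groupV.
- by rewrite leqNgt ltn_ord.
exists (size u); apply/existsP; exists (in_tuple u); rewrite /= Pu /=.
have fol v : foldl permcomp v u = permcomp v (foldl permcomp 1%g u).
  elim/last_ind: u {Pu tu} => [|u w IHu] /=; first by rewrite /permcomp mul1g.
  by rewrite -cats1 !foldl_cat /= IHu /permcomp mulgA.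
by rewrite fol -tu /permcomp mulgKV.
Qed.

End Permutations.

Section FiniteMeasures.
Variables (R : realType) (T : finType).
Implicit Types (A : {set T}) (nu mu : T -> R).

Definition prob A nu : Prop :=
  [/\ forall x, 0 <= nu x, forall x, x \notin A -> nu x = 0
    & \sum_(x in A) nu x = 1].

Definition unif A (x : T) : R := if x \in A then #|A|%:R^-1 else 0.

(* Where [nu] vanishes the summand is 0, whatever the value of [ln 0]. *)
Definition entropy nu mu : \bar R :=
  if [forall x, (mu x == 0) ==> (nu x == 0)]
  then (\sum_x nu x * ln (nu x / mu x))%:E else +oo%E.

End FiniteMeasures.

Section Transport.
Variables (R : realType) (T : finType) (A : {set T}).
Implicit Types (nu : T -> R) (d : T -> T -> nat).

Definition coupling nu1 nu2 (pi : T * T -> R) : Prop :=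
  [/\ prob (finset.setX A A) pi,
      forall x, x \in A -> \sum_(y in A) pi (x, y) = nu1 x
    & forall y, y \in A -> \sum_(x in A) pi (x, y) = nu2 y].

Definition disintegration nu1 (pi : T * T -> R) (p : T -> T -> R) : Prop :=
  (forall x, x \in A -> prob A (p x)) /\
  (forall x y, x \in A -> y \in A -> pi (x, y) = nu1 x * p x y).

Definition W1 d nu1 nu2 : R :=
  inf [set c | exists2 pi, coupling nu1 nu2 pi
    & c = \sum_(x in A) \sum_(y in A) (d x y)%:R * pi (x, y)]%classic.

Definition T2tilde d nu2 nu1 : R :=
  inf [set c | exists pi p,
    [/\ coupling nu1 nu2 pi, disintegration nu1 pi p
      & c = \sum_(x in A) (\sum_(y in A) (d x y)%:R * p x y) ^+ 2 * nu1 x]]%classic.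

(* The sets of costs are nonempty, so that these infima (over sets of
   nonnegative reals) are the true ones. *)
Lemma coupling_disintegration nu1 nu2 : prob A nu1 -> prob A nu2 ->
  let pi := fun xy : T * T => nu1 xy.1 * nu2 xy.2 in
  coupling nu1 nu2 pi /\ disintegration nu1 pi (fun=> nu2).
Proof.
move=> p1 p2; split; last by split.
case: (p1) (p2) => [nu1_ge0 nu1_out nu1_1] [nu2_ge0 nu2_out nu2_1].
split.
- split=> [xy|[x y]|]; first exact: mulr_ge0.
    rewrite finset.in_setX negb_and => /orP[/nu1_out|/nu2_out] /= ->.
      by rewrite mul0r.
    by rewrite mulr0.
  transitivity (\sum_(x in A) \sum_(y in A) nu1 x * nu2 y).
    rewrite pair_big_dep /=; apply: eq_bigl => -[x y].
    by rewrite finset.in_setX.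
  by under eq_bigr do rewrite -mulr_sumr nu2_1 mulr1.
- by move=> x xA /=; rewrite -mulr_sumr nu2_1 mulr1.
- by move=> y yA /=; rewrite -mulr_suml nu1_1 mul1r.
Qed.

End Transport.

Section PermutationTransport.
Variables (R : realType) (n : nat) (G : {group 'S_n}).
Implicit Types (mu nu : 'S_n -> R).

Definition T2hat nu2 nu1 : R :=
  inf [set c | exists pi p,
    [/\ coupling G nu1 nu2 pi, disintegration G nu1 pi p
      & c = \sum_(s in G)
              (\sum_(i < n) (\sum_(t in G) (s i != t i)%:R * p s t) ^+ 2)
              * nu1 s]]%classic.

(* By [localorb0], [family (localorb G)] is the product of the O_j for j in {2, ..., n},
   with a dummy first coordinate. *)
Definition MT (t : 'I_n -> 'I_n -> 'S_n) mu : Prop :=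
  exists nuh : 'I_n -> 'I_n -> R,
    (forall j : 'I_n, (0 < j)%N -> prob (localorb G j) (nuh j)) /\
    (forall s, mu s = \sum_(x in family (localorb G) | Umap t x == s)
                        \prod_(j < n | (0 < j)%N) nuh j (x j)).

Definition entropy_term mu nu1 nu2 : \bar R :=
  ((entropy nu1 mu `^ 2^-1 + entropy nu2 mu `^ 2^-1) ^+ 2)%E.

Definition W1_ineq mu (d : 'S_n -> 'S_n -> nat) (c : R) : Prop :=
  forall nu1 nu2, prob G nu1 -> prob G nu2 ->
    ((2 / c ^+ 2 * W1 G d nu1 nu2 ^+ 2)%:E
      <= (Kn G)%:R%:E * entropy_term mu nu1 nu2)%E.

Definition T2tilde_ineq mu (d : 'S_n -> 'S_n -> nat) (c : R) : Prop :=
  forall nu1 nu2, prob G nu1 -> prob G nu2 ->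
    (((2 * c ^+ 2)^-1 * T2tilde G d nu2 nu1)%:E
      <= (Kn G)%:R%:E * entropy_term mu nu1 nu2)%E.

Definition T2hat_ineq mu (csq : R) : Prop :=
  forall nu1 nu2, prob G nu1 -> prob G nu2 ->
    (((2 * csq)^-1 * T2hat nu2 nu1)%:E <= entropy_term mu nu1 nu2)%E.

End PermutationTransport.

(* Main.v *)
From HB Require Import structures.
Require Import Defs.
From mathcomp Require Import all_boot all_order all_algebra all_fingroup.
From mathcomp Require Import all_classical all_reals all_analysis.
From mathcomp Require Import ring lra.

(* All inequalities are proved by building one coupling, as a transition kernel,
   by revealing the random permutation coordinate by coordinate. The squared sum
   (sqrt x + sqrt y)^2 is the infimum of a x + b y over 1/a + 1/b = 1, so with a
   and b fixed every bound is linear in the entropies and survives both the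
   chain rule and averaging over the cells of a partition.

   If the cells {s : s^-1(m) = i} are matched by multiplications by permutations
   r_ij moving few points, the maximal coupling of the two laws of s^-1(m) is
   glued with couplings inside the cells. For one coordinate, Pinsker's and
   Marton's inequalities bound the first and second moments of the probability
   q_i of leaving cell i. Revealing the values n, ..., 2 in turn gives (a), with
   one term for each nontrivial orbit.

   For (b) the induction hypothesis is strengthened to
     E sum_k (P(s(k) <> s'(k) | s) + u_k)^2
       <= 2 (sum u)^2 + 2 c^2 (a H_1 + b H_2)      for every u >= 0,
   which is stable because u is the mean, with weights u_m / sum u, of the
   perturbations (sum u) 1_m: reveal the position m with this probability. Then
   the perturbation costs 2 (sum u)^2 + 2 q_i^2 at m, while matching the cells
   s(m) = i by left multiplications perturbs the remaining problem, read on the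
   values instead of the positions, by a vector of sum at most (L - 1) q_i. This
   yields c^2 = 2 (L - 1)^2 + 2 when all cells, in both readings, are matched by
   permutations of degree at most L: by locality L = l for the uniform law, and
   L = 2 l - 1 for the products t_i t_j^-1 of the local base in the normal case. *)

Set Implicit Arguments.
Unset Strict Implicit.
Unset Printing Implicit Defensive.

Import Order.TTheory GRing.Theory Num.Theory.
Import numFieldNormedType.Exports.

Local Open Scope ring_scope.

(** * Entropy inequalities on a finite set *)

Section ScalarInequalities.
Variable R : realType.

(** Chosen so that [2 * x * (x + 2) * (g x - g 1)] is the difference of the two sides of [xlnx_ge].
    Its derivative is [(x - 1)^3] over a positive quantity, hence a minimum at 1. *)
Let g (x : R) : R := ln x + 4^-1 * x^-1 + 27 / 4 * (x + 2)^-1.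

Let g_derive (x : R) : 0 < x ->
  is_derive x 1 g (x^-1 - 4^-1 * x ^- 2 - 27 / 4 * (x + 2) ^- 2).
Proof.
move=> x0.
have h1 := is_derive1_ln x0.
have xn0 : x != 0 by rewrite gt_eqF.
have x2n0 : x + 2 != 0 by rewrite gt_eqF// addr_gt0.
have h2 : is_derive x 1 (fun y : R => y^-1) (- x ^- 2 *: 1).
  exact: is_deriveV.
have h3 : is_derive x 1 (fun y : R => (y + 2)^-1) (- (x + 2) ^- 2 *: 1).
  have h4 : is_derive x 1 (fun y : R => y + 2) 1.
    by apply: is_derive_eq; rewrite addr0.
  exact: (@is_deriveV _ (fun y : R => y + 2) x 1 1 x2n0 h4).
rewrite /g; apply: is_derive_eq.
rewrite !scaler1 /GRing.scale/=; ring.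
Qed.

Let g_deriveE (x : R) : 0 < x ->
  g^`()%classic x = (x - 1) ^+ 3 / (x ^+ 2 * (x + 2) ^+ 2).
Proof.
move=> x0; rewrite derive1E (@derive_val _ _ _ _ _ _ _ (g_derive x0)).
by field; rewrite !gt_eqF// addr_gt0.
Qed.

Let g_cont (i : interval R) : ([set` i] `<=` [set x : R | 0 < x])%classic ->
  {within [set` i], continuous g}%classic.
Proof.
move=> ipos; apply: continuous_in_subspaceT => x; rewrite inE => /ipos /= x0.
apply: differentiable_continuous; apply/derivable1_diffP.
exact: (@ex_derive _ _ _ _ _ _ _ (g_derive x0)).
Qed.

Let g_ge (x : R) : 0 < x -> g 1 <= g x.
Proof.
move=> x0; have [x1|x1] := leP x 1.
- apply: (@ler0_derive1_nincr _ g x 1) => //.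
  + move=> y; rewrite in_itv/= => /andP[xy _].
    exact: (@ex_derive _ _ _ _ _ _ _ (g_derive (lt_trans x0 xy))).
  + move=> y; rewrite in_itv/= => /andP[xy y1].
    have y0 := lt_trans x0 xy.
    rewrite g_deriveE// pmulr_lle0.
      by rewrite exprS mulr_le0_ge0// ?sqr_ge0// subr_le0 ltW.
    by rewrite invr_gt0 mulr_gt0// exprn_gt0// addr_gt0.
  + apply: g_cont => y /=; rewrite in_itv/= => /andP[xy _].
    exact: lt_le_trans xy.
- apply: (@ger0_derive1_ndecr _ g 1 x) => //; last exact: ltW.
  + move=> y; rewrite in_itv/= => /andP[y1 _].
    exact: (@ex_derive _ _ _ _ _ _ _ (g_derive (lt_trans ltr01 y1))).
  + move=> y; rewrite in_itv/= => /andP[y1 _].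
    have y0 := lt_trans ltr01 y1.
    rewrite g_deriveE// divr_ge0//; first by rewrite exprn_ge0// subr_ge0 ltW.
    by rewrite mulr_ge0// sqr_ge0.
  + apply: g_cont => y /=; rewrite in_itv/= => /andP[y1 _].
    exact: lt_le_trans y1.
Qed.

(* Dominates both the quadratic and the one-sided lower bounds of the relative
   entropy used in Pinsker's and Marton's inequalities. *)
Lemma xlnx_ge (x : R) : 0 <= x ->
  3 * (x - 1) ^+ 2 <= 2 * (x + 2) * (x * ln x - x + 1).
Proof.
rewrite le_eqVlt => /predU1P[<-|x0]; first by rewrite mul0r; lra.
have := g_ge x0; rewrite /g ln1 => gx.
have x2 : 0 < x + 2 by lra.
have : 0 <= 2 * x * (x + 2) *
    (ln x + 4^-1 * x^-1 + 27 / 4 * (x + 2)^-1 - (0 + 4^-1 * 1^-1 + 27 / 4 * (1 + 2)^-1)).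
  by rewrite mulr_ge0 ?subr_ge0// !mulr_ge0// ltW.
suff -> : 2 * x * (x + 2) * (ln x + 4^-1 * x^-1 + 27 / 4 * (x + 2)^-1
    - (0 + 4^-1 * 1^-1 + 27 / 4 * (1 + 2)^-1)) =
    2 * (x + 2) * (x * ln x - x + 1) - 3 * (x - 1) ^+ 2 by rewrite subr_ge0.
by field; rewrite !gt_eqF.
Qed.

Lemma sqrD_conj_le (al be x y : R) : 0 < al -> 0 < be -> al^-1 + be^-1 = 1 ->
  (x + y) ^+ 2 <= al * x ^+ 2 + be * y ^+ 2.
Proof.
move=> al0 be0 albe.
have al1 : 1 <= al.
  by rewrite -(invrK al) invf_ge1 ?invr_gt0// -albe lerDl invr_ge0 ltW.
have e : al + be = al * be.
  rewrite -[RHS]mulr1 -albe; field; by rewrite !gt_eqF.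
(* Conjugacy in the form [al + be = al * be] kills the last term; the gap is then [al - 1 >= 0]
   times a square. *)
have -> : al * x ^+ 2 + be * y ^+ 2 = (x + y) ^+ 2
    + (al - 1) * (x - (be - 1) * y) ^+ 2
    + (al + be - al * be) * ((be - 1) * y ^+ 2 - 2 * x * y) by ring.
by rewrite e subrr mul0r addr0 lerDl mulr_ge0 ?sqr_ge0// subr_ge0.
Qed.

(** [a] and [b] are the densities of the two laws with respect to [mu]. By [xlnx_ge],
    [(a - 1)^2 <= 2 * a * ea] for [a >= 1] and [(b - 1)^2 <= 2 * eb] for [b <= 1]; the extra factor
    [a] in the first bound is absorbed by the division by [a]. *)
Lemma marton_pointwise (al be a b : R) : 0 < al -> 0 < be -> al^-1 + be^-1 = 1 ->
  0 < a -> 0 <= b ->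
  Num.max 0 (a - b) ^+ 2 / a <=
    2 * (al * (a * ln a - a + 1) + be * (b * ln b - b + 1)).
Proof.
move=> al0 be0 albe a0 b0.
have al1 : 1 <= al.
  by rewrite -(invrK al) invf_ge1 ?invr_gt0// -albe lerDl invr_ge0 ltW.
have be1 : 1 <= be.
  by rewrite -(invrK be) invf_ge1 ?invr_gt0// -albe lerDr invr_ge0 ltW.
have Ea := xlnx_ge (ltW a0); have Eb := xlnx_ge b0.
set ea := a * ln a - a + 1 in Ea *; set eb := b * ln b - b + 1 in Eb *.
have ea0 : 0 <= ea.
  have : 0 <= 2 * (a + 2) * ea by apply: le_trans Ea; rewrite mulr_ge0// sqr_ge0.
  by rewrite pmulr_rge0//; lra.
have eb0 : 0 <= eb.
  have : 0 <= 2 * (b + 2) * eb by apply: le_trans Eb; rewrite mulr_ge0// sqr_ge0.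
  by rewrite pmulr_rge0//; lra.
have [ab|ba] := leP (a - b) 0.
  by rewrite expr0n mul0r mulr_ge0// addr_ge0// mulr_ge0// ltW.
have Ha : 1 <= a -> (a - 1) ^+ 2 <= 2 * a * ea.
  move=> a1; have h : 0 <= (a - 1) * (a - 1) ^+ 2.
    by rewrite mulr_ge0 ?sqr_ge0// subr_ge0.
  rewrite -(ler_pM2l (_ : 0 < a + 2)); last lra.
  have := mulr_ge0 (ltW a0) (sqr_ge0 (a - 1)).
  have := ler_wpM2l (ltW a0) Ea; nra.
have Hb : b <= 1 -> (b - 1) ^+ 2 <= 2 * eb.
  move=> b1; rewrite -(ler_pM2l (_ : 0 < b + 2)); last lra.
  have : 0 <= (1 - b) * (b - 1) ^+ 2 by rewrite mulr_ge0 ?sqr_ge0// subr_ge0.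
  nra.
rewrite ler_pdivrMr// ?lt_max ?a0//.
(* Here [b < a < 1], so [a - b <= a * (1 - b)] and the entropy of [b] alone suffices. *)
have [a1|a1] := leP 1 a; last first.
  have /Hb {}Hb : b <= 1 by lra.
  apply: (@le_trans _ _ (a * (b - 1) ^+ 2)).
    have h : (a - b) ^+ 2 <= (a * (1 - b)) ^+ 2.
      by rewrite ler_sqr ?nnegrE; nra.
    apply: le_trans h _; rewrite exprMn (_ : (1 - b) ^+ 2 = (b - 1) ^+ 2); last by ring.
    by rewrite ler_wpM2r ?sqr_ge0// expr2 ler_piMl// ltW.
  have := ler_wpM2l (ltW a0) Hb.
  have : 0 <= a * (al * ea) by rewrite !mulr_ge0// ltW.
  have : 0 <= a * ((be - 1) * eb) by rewrite !mulr_ge0// ?subr_ge0// ltW.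
  nra.
have {}Ha := Ha a1.
(* Here [1 < b < a], so [a - b <= a - 1] and the entropy of [a] alone suffices. *)
have [b1|b1] := leP b 1; last first.
  apply: (@le_trans _ _ ((a - 1) ^+ 2)).
    by rewrite ler_sqr ?nnegrE; lra.
  have : 0 <= a * ((al - 1) * ea) by rewrite !mulr_ge0// ?subr_ge0// ltW.
  have : 0 <= a * (be * eb) by rewrite !mulr_ge0// ltW.
  nra.
have {}Hb := Hb b1.
(* In the remaining case [b <= 1 <= a] both densities contribute, joined by the conjugate
   weights. *)
have -> : a - b = (a - 1) + (1 - b) by ring.
apply: (le_trans (sqrD_conj_le _ _ al0 be0 albe)).
rewrite (_ : (1 - b) ^+ 2 = (b - 1) ^+ 2); last by ring.
have := ler_wpM2l (ltW al0) Ha.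
have := ler_wpM2l (ltW be0) Hb.
have : 0 <= (a - 1) * (be * (2 * eb)) by rewrite !mulr_ge0// ?subr_ge0// ltW.
nra.
Qed.

End ScalarInequalities.

(** * Relative entropy, Pinsker's and Marton's inequalities, and the maximal coupling *)

Section FiniteDistributions.
Variables (R : realType) (T : finType).
Implicit Types (mu nu w : T -> R) (p : T -> T -> R) (al be : R).

Definition distr nu : Prop := (forall x, 0 <= nu x) /\ \sum_x nu x = 1.

Definition dominated nu mu : Prop := forall x, mu x = 0 -> nu x = 0.

Definition rel_ent nu mu : R := \sum_x nu x * ln (nu x / mu x).

(* Only the rows [p x] with [nu1 x != 0] matter. *)
Definition transports nu1 nu2 p : Prop :=
  (forall x, nu1 x != 0 -> distr (p x)) /\
  (forall y, \sum_x nu1 x * p x y = nu2 y).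

Lemma distr_ge0 nu : distr nu -> forall x, 0 <= nu x.
Proof. by case. Qed.

Lemma distr_neq0 nu : distr nu -> exists x, nu x != 0.
Proof.
move=> [_ nu1]; apply/existsP; apply: contraTT (oner_neq0 R) => /existsPn nu0.
rewrite negbK -nu1 big1// => x _; apply/eqP.
by have := nu0 x; rewrite negbK.
Qed.

Lemma jensen_sqr w (a : T -> R) : distr w ->
  (\sum_x w x * a x) ^+ 2 <= \sum_x w x * a x ^+ 2.
Proof.
move=> [w0 w1]; move mE: (\sum_x w x * a x) => m.
have : 0 <= \sum_x w x * (a x - m) ^+ 2.
  by apply: sumr_ge0 => x _; rewrite mulr_ge0// sqr_ge0.
have -> : \sum_x w x * (a x - m) ^+ 2
    = \sum_x w x * a x ^+ 2 - 2 * m * m + m ^+ 2 * \sum_x w x.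
  have -> : 2 * m * m = \sum_x 2 * m * (w x * a x) by rewrite -mulr_sumr mE.
  rewrite mulr_sumr -sumrB -big_split /=.
  by apply: eq_bigr => x _; ring.
rewrite w1; nra.
Qed.

(** Both masses being 1, the added terms cancel in the sum; they make every summand nonnegative, so
    that pointwise bounds apply. *)
Lemma rel_entE nu mu : distr nu -> distr mu -> dominated nu mu ->
  rel_ent nu mu =
    \sum_x mu x * (nu x / mu x * ln (nu x / mu x) - nu x / mu x + 1).
Proof.
move=> [nu0 nu1] [mu0 mu1] numu.
transitivity (rel_ent nu mu - \sum_x nu x + \sum_x mu x); first by rewrite nu1 mu1; ring.
rewrite /rel_ent -sumrB -big_split /=; apply: eq_bigr => x _.
have [mux|mux] := eqVneq (mu x) 0; last by field.
by rewrite (numu _ mux) mux; ring.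
Qed.

Lemma rel_ent_ge0 nu mu : distr nu -> distr mu -> dominated nu mu ->
  0 <= rel_ent nu mu.
Proof.
move=> dnu dmu numu; rewrite rel_entE//; apply: sumr_ge0 => x _.
apply: mulr_ge0; first exact: distr_ge0.
have a0 : 0 <= nu x / mu x by apply: divr_ge0; exact: distr_ge0.
have := xlnx_ge a0; set a := nu x / mu x in a0 *; set E := (_ - _ + _) => h.
have : 0 <= 2 * (a + 2) * E by apply: le_trans h; rewrite mulr_ge0// sqr_ge0.
by rewrite pmulr_rge0//; lra.
Qed.

Lemma pinsker nu mu : distr nu -> distr mu -> dominated nu mu ->
  (\sum_x `|nu x - mu x|) ^+ 2 <= 2 * rel_ent nu mu.
Proof.
move=> dnu dmu numu; set V : R := \sum_x _; have H0 := rel_ent_ge0 dnu dmu numu.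
have V0 : 0 <= V by apply: sumr_ge0.
(* Pinsker's inequality linearised in the entropy: at each point [xlnx_ge] and the
   arithmetic-geometric inequality apply, and the factor [2 / 3] comes from the total mass 3 of
   [nu + 2 mu]. *)
have key (s : R) : 0 < s -> 2 * V <= 2 * s + rel_ent nu mu / s.
  move=> s0; rewrite rel_entE// mulr_sumr mulr_suml.
  have -> : 2 * s = \sum_x (s * (2 / 3) * (nu x + 2 * mu x)).
    rewrite -mulr_sumr big_split /= -mulr_sumr dnu.2 dmu.2; by field.
  rewrite -big_split /=; apply: ler_sum => x _.
  have [mux|mux] := eqVneq (mu x) 0.
    by rewrite (numu _ mux) mux !(subrr, normr0, mulr0, mul0r, addr0).
  set a := nu x / mu x.
  have mux0 : 0 < mu x by rewrite lt_neqAle eq_sym mux distr_ge0.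
  have nuE : nu x = mu x * a by rewrite mulrC divfK.
  have a0 : 0 <= a by apply: divr_ge0; exact: distr_ge0.
  have := xlnx_ge a0; set E := (_ - _ + _) => h.
  have E0 : 0 <= E.
    have : 0 <= 2 * (a + 2) * E by apply: le_trans h; rewrite mulr_ge0// sqr_ge0.
    by rewrite pmulr_rge0//; lra.
  rewrite nuE -[X in mu x * a - X]mulr1 -mulrBr normrM (gtr0_norm mux0).
  have -> : s * (2 / 3) * (mu x * a + 2 * mu x) + mu x * E / s
      = mu x * (s * (2 / 3) * (a + 2) + E / s) by ring.
  rewrite mulrCA ler_pM2l//.
  have r0 : 0 <= s * (2 / 3) * (a + 2) + E / s.
    by rewrite addr_ge0 ?divr_ge0 ?(ltW s0)// !mulr_ge0 ?(ltW s0)//; lra.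
  rewrite -ler_sqr ?nnegrE ?mulr_ge0// exprMn real_normK ?num_real//.
  have -> : (s * (2 / 3) * (a + 2) + E / s) ^+ 2 =
      (s * (2 / 3) * (a + 2) - E / s) ^+ 2 + 4 * ((2 * (a + 2) * E) / 3).
    by field; rewrite gt_eqF.
  have := sqr_ge0 (s * (2 / 3) * (a + 2) - E / s); lra.
have [->|Vn0] := eqVneq V 0; first by rewrite expr0n mulr_ge0.
have Vgt0 : 0 < V by rewrite lt_neqAle eq_sym Vn0.
(* [s = V / 2] is the choice that gives back [V ^+ 2 <= 2 * rel_ent nu mu]. *)
have := key (V / 2) (divr_gt0 Vgt0 (ltr0n R 2)).
rewrite -(ler_pM2l Vgt0) => h.
have : V * (2 * (V / 2) + rel_ent nu mu / (V / 2)) = V ^+ 2 + 2 * rel_ent nu mu.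
  by field.
nra.
Qed.

Section OptimalKernel.
Variables nu1 nu2 : T -> R.
Hypotheses (d1 : distr nu1) (d2 : distr nu2).

Definition pospart (x : R) : R := Num.max 0 x.

(** The conditional probability that the maximal coupling leaves [x]; it is 0 where [nu1] vanishes,
    by the convention on division by 0. *)
Definition moverate x : R := pospart (nu1 x - nu2 x) / nu1 x.

Let ppB x : nu1 x - nu2 x = pospart (nu1 x - nu2 x) - pospart (nu2 x - nu1 x).
Proof. by rewrite /pospart; case: (leP 0 (nu1 x - nu2 x)); case: (leP 0 (nu2 x - nu1 x)); lra. Qed.

Let pp_ge0 x : 0 <= pospart x. Proof. by rewrite le_max lexx. Qed.

Lemma mulr_moverate x : nu1 x * moverate x = pospart (nu1 x - nu2 x).
Proof.
rewrite /moverate; have [nu10|nu10] := eqVneq (nu1 x) 0; last by field.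
by rewrite nu10 mul0r sub0r /pospart max_l// oppr_le0 distr_ge0.
Qed.

Lemma moverate_ge0 x : 0 <= moverate x.
Proof. by rewrite divr_ge0// distr_ge0. Qed.

(* The kernel of the maximal coupling: it moves mass only from where
   [nu1 > nu2] to where [nu2 > nu1]. *)
Lemma optimal_kernel : exists2 p, transports nu1 nu2 p
  & forall x, nu1 x != 0 -> \sum_y p x y * (x != y)%:R = moverate x.
Proof.
pose D := \sum_x pospart (nu1 x - nu2 x).
have DE : D = \sum_x pospart (nu2 x - nu1 x).
  apply/eqP; rewrite -subr_eq0 -sumrB -(eq_bigr _ (fun x _ => ppB x)) sumrB.
  by rewrite d1.2 d2.2 subrr.
have D0 : D = 0 -> forall x, pospart (nu1 x - nu2 x) = 0 /\ pospart (nu2 x - nu1 x) = 0.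
  move=> D0 x; split; apply/eqP; rewrite eq_le pp_ge0 andbT.
    by rewrite -D0 /D (bigD1 x)//= lerDl sumr_ge0.
  by rewrite -D0 DE (bigD1 x)//= lerDl sumr_ge0.
(* Stay with probability [1 - moverate x]; otherwise draw the target from the normalised excess of
   [nu2] over [nu1]. If [D = 0] the two laws agree and nothing moves. *)
pose p x y := (x == y)%:R * (1 - moverate x) + moverate x * (pospart (nu2 y - nu1 y) / D).
have rate1 x : nu1 x != 0 -> moverate x * \sum_y (pospart (nu2 y - nu1 y) / D) = moverate x.
  move=> x0; have [/D0 e|Dn0] := eqVneq D 0.
    by rewrite /moverate (e x).1 !mul0r.
  by rewrite -mulr_suml -DE divff// mulr1.
have diag (h : T -> R) x : \sum_y (x == y)%:R * h y = h x.
  rewrite (bigD1 x)//= eqxx mul1r big1 ?addr0// => y.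
  by rewrite eq_sym => /negbTE ->; rewrite mul0r.
exists p; first split=> [x x0|y].
- split=> [y|]; last first.
    by rewrite big_split /= (diag (fun=> 1 - moverate x)) -mulr_sumr rate1// subrK.
  rewrite addr_ge0// mulr_ge0 ?moverate_ge0//; last first.
    by rewrite divr_ge0// sumr_ge0.
  rewrite subr_ge0 ler_pdivrMr ?lt_neqAle ?[0 == _]eq_sym ?x0 ?distr_ge0//.
  rewrite mul1r /pospart ge_max distr_ge0//= gerBl distr_ge0//.
- transitivity (\sum_x (y == x)%:R * (nu1 x * (1 - moverate x))
      + \sum_x pospart (nu1 x - nu2 x) * (pospart (nu2 y - nu1 y) / D)).
    rewrite -big_split /=; apply: eq_bigr => x _; rewrite /p -mulr_moverate eq_sym; ring.
  rewrite diag -mulr_suml -/D mulrBr mulr1 mulr_moverate.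
  have [De|Dn0] := eqVneq D 0.
    by rewrite De mul0r; have := ppB y; have [-> ->] := D0 De y; lra.
  by rewrite mulrCA divff// mulr1; have := ppB y; lra.
- move=> x x0; transitivity (\sum_y (moverate x * (pospart (nu2 y - nu1 y) / D)
      - (x == y)%:R * (moverate x * (pospart (nu2 y - nu1 y) / D)))).
    by apply: eq_bigr => y _; rewrite /p; case: eqP => _ /=; ring.
  rewrite sumrB diag -mulr_sumr rate1//.
  suff -> : moverate x * (pospart (nu2 x - nu1 x) / D) = 0 by rewrite subr0.
  rewrite /moverate /pospart; case: (leP (nu1 x - nu2 x) 0) => h.
    by rewrite !mul0r.
  by rewrite (max_l (_ : nu2 x - nu1 x <= 0)) ?mul0r ?mulr0//; lra.
Qed.

Variables (mu : T -> R) (al be : R).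
Hypotheses (dmu : distr mu) (ac1 : dominated nu1 mu) (ac2 : dominated nu2 mu).
Hypotheses (al0 : 0 < al) (be0 : 0 < be) (albe : al^-1 + be^-1 = 1).

(** [marton_pointwise] for the densities [nu1 x / mu x] and [nu2 x / mu x], integrated against
    [mu]. *)
Lemma marton_base : \sum_x nu1 x * moverate x ^+ 2 <=
  2 * (al * rel_ent nu1 mu + be * rel_ent nu2 mu).
Proof.
rewrite !rel_entE// [al * _]mulr_sumr [be * _]mulr_sumr -big_split mulr_sumr /=.
apply: ler_sum => x _; have [mux|mux] := eqVneq (mu x) 0.
  by rewrite ac1// mux !(mul0r, mulr0) addr0.
have mux0 : 0 < mu x by rewrite lt_neqAle eq_sym mux distr_ge0.
have [nux|nux] := eqVneq (nu1 x) 0.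
  rewrite nux mul0r; set E1 := (_ - _ + _); set E2 := (_ - _ + _).
  have E10 : E1 = 1 by rewrite /E1 !(mul0r, subr0, add0r).
  have E20 : 0 <= E2.
    have b0 : 0 <= nu2 x / mu x by apply: divr_ge0; exact: distr_ge0.
    have := xlnx_ge b0; rewrite -/E2 => h.
    have : 0 <= 2 * (nu2 x / mu x + 2) * E2.
      by apply: le_trans h; rewrite mulr_ge0// sqr_ge0.
    by rewrite pmulr_rge0//; lra.
  rewrite E10; rewrite mulr_ge0// addr_ge0// ?mulr_ge0// ltW//.
have nux0 : 0 < nu1 x by rewrite lt_neqAle eq_sym nux distr_ge0.
have a0 : 0 < nu1 x / mu x by exact: divr_gt0.
have b0 : 0 <= nu2 x / mu x by apply: divr_ge0; exact: distr_ge0.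
have := marton_pointwise al0 be0 albe a0 b0.
rewrite -(ler_pM2l mux0); set E1 := (_ - _ + _); set E2 := (_ - _ + _) => h.
have -> : 2 * (al * (mu x * E1) + be * (mu x * E2)) = mu x * (2 * (al * E1 + be * E2)) by ring.
apply: le_trans h; rewrite -mulrBl.
have -> : Num.max 0 ((nu1 x - nu2 x) / mu x) = pospart (nu1 x - nu2 x) / mu x.
  by rewrite -[X in Num.max X](mul0r (mu x)^-1) -maxr_pMl// invr_ge0 ltW.
by rewrite le_eqVlt /moverate; apply/orP; left; apply/eqP; field; exact/andP.
Qed.

(** The moved mass is half the [L^1] distance of [nu1] and [nu2]; the triangle inequality through
    [mu] reduces it to two uses of Pinsker. *)
Lemma pinsker_base : (\sum_x nu1 x * moverate x) ^+ 2 <=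
  (al * rel_ent nu1 mu + be * rel_ent nu2 mu) / 2.
Proof.
have -> : \sum_x nu1 x * moverate x = \sum_x `|nu1 x - nu2 x| / 2.
  transitivity (\sum_x (`|nu1 x - nu2 x| / 2 + (nu1 x - nu2 x) / 2)); last first.
    by rewrite big_split /= -[X in _ + X]mulr_suml sumrB d1.2 d2.2 subrr mul0r addr0.
  apply: eq_bigr => x _; rewrite mulr_moverate /pospart.
  by case: (leP 0 (nu1 x - nu2 x)) => h; [rewrite ger0_norm//|rewrite ltr0_norm//]; lra.
rewrite -mulr_suml.
have p1 := pinsker d1 dmu ac1; have p2 := pinsker d2 dmu ac2.
have V0 : 0 <= \sum_x `|nu1 x - nu2 x| by apply: sumr_ge0.
have : \sum_x `|nu1 x - nu2 x| <= \sum_x `|nu1 x - mu x| + \sum_x `|nu2 x - mu x|.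
  rewrite -big_split /=; apply: ler_sum => x _.
  by rewrite [X in _ <= _ + X]distrC; apply: le_trans (ler_normD _ _); rewrite subrKA.
rewrite -ler_sqr ?nnegrE ?addr_ge0 ?sumr_ge0// => h.
have := le_trans h (sqrD_conj_le _ _ al0 be0 albe).
have := ler_wpM2l (ltW al0) p1; have := ler_wpM2l (ltW be0) p2.
rewrite exprMn; lra.
Qed.

End OptimalKernel.

End FiniteDistributions.

Lemma transports_neq0 (R : realType) (I : finType) (w1 w2 : I -> R) (ph : I -> I -> R) i j : transports w1 w2 ph ->
  distr w1 -> w1 i != 0 -> ph i j != 0 -> w2 j != 0.
Proof.
move=> [dph <-] d1 i0 p0; rewrite gt_eqF// (bigD1 i)//= ltr_pwDl//.
  rewrite mulr_gt0// lt_neqAle eq_sym ?i0 ?p0 ?distr_ge0//; exact: dph.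
apply: sumr_ge0 => k _; have [->|k0] := eqVneq (w1 k) 0; first by rewrite mul0r.
by rewrite mulr_ge0 ?distr_ge0//; exact: dph.
Qed.

(** * Gluing couplings along a partition *)

Section Conditioning.
Variables (R : realType) (T I : finType).
Implicit Types (mu nu : T -> R) (w : I -> R) (mus : I -> T -> R).

(* [mu] is the mixture of the [mus i], carried by the fibres of [e], and the
   [f i j] identify the components with one another. *)
Definition fibred (e : T -> I) w mus (f : I -> I -> T -> T) mu : Prop :=
  [/\ distr w, forall i, w i != 0 -> distr (mus i),
      forall i x, w i != 0 -> mus i x != 0 -> e x = i,
      forall x, mu x = \sum_i w i * mus i x
    & forall i j, w i != 0 -> w j != 0 ->
        injective (f i j) /\ forall x, mus j (f i j x) = mus i x].

Definition marg (e : T -> I) nu i : R := \sum_(x | e x == i) nu x.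

Definition cond (e : T -> I) nu i x : R := (e x == i)%:R * nu x / marg e nu i.

Lemma sum_fibre (e : T -> I) (F : T -> R) :
  \sum_i \sum_(x | e x == i) F x = \sum_x F x.
Proof. by rewrite [RHS](partition_big e xpredT). Qed.

Lemma sum_bij (f : T -> T) (F : T -> R) : injective f -> \sum_x F (f x) = \sum_x F x.
Proof. by move=> finj; rewrite [RHS](reindex_inj finj). Qed.

Lemma sum_pick (f : T -> T) (F : T -> R) y : injective f ->
  \sum_x F (f x) * (f x == y)%:R = F y.
Proof.
move=> finj; rewrite (sum_bij (fun z => F z * (z == y)%:R) finj).
rewrite (bigD1 y)//= eqxx mulr1 big1 ?addr0// => z /negbTE ->.
by rewrite mulr0.
Qed.

Section OneMeasure.
Variables (e : T -> I) (nu : T -> R).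
Hypothesis dnu : distr nu.

Lemma marg_distr : distr (marg e nu).
Proof.
split=> [i|]; first by apply: sumr_ge0 => x _; exact: distr_ge0.
by rewrite sum_fibre dnu.2.
Qed.

Lemma marg_neq0 x : nu x != 0 -> marg e nu (e x) != 0.
Proof.
move=> x0; rewrite gt_eqF// /marg (bigD1 x)//= ltr_pwDl//.
  by rewrite lt_neqAle eq_sym x0 distr_ge0.
by apply: sumr_ge0 => y _; exact: distr_ge0.
Qed.

Lemma cond_ge0 i x : 0 <= cond e nu i x.
Proof.
apply: divr_ge0; last exact: (distr_ge0 marg_distr).
by rewrite mulr_ge0// distr_ge0.
Qed.

Lemma cond_distr i : marg e nu i != 0 -> distr (cond e nu i).
Proof.
move=> i0; split=> [x|]; first exact: cond_ge0.
rewrite /cond -mulr_suml; apply: (mulIf i0); rewrite divfK// mul1r.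
by rewrite /marg [RHS]big_mkcond; apply: eq_bigr => x _; case: eqP; rewrite (mul1r, mul0r).
Qed.

Lemma cond_neq0 i x : cond e nu i x != 0 -> e x = i /\ nu x != 0.
Proof.
rewrite /cond; case: (e x =P i) => [-> |_]; last by rewrite !mul0r eqxx.
rewrite mul1r => h; split=> //; apply: contraNneq h => ->.
by rewrite mul0r.
Qed.

Lemma marg_cond x : marg e nu (e x) * cond e nu (e x) x = nu x.
Proof.
rewrite /cond eqxx mul1r; have [x0|/marg_neq0 x0] := eqVneq (nu x) 0.
  by rewrite x0 mul0r mulr0.
by rewrite mulrC divfK.
Qed.

Lemma sum_cond (F : I -> T -> R) :
  \sum_x nu x * F (e x) x = \sum_i marg e nu i * \sum_x cond e nu i x * F i x.
Proof.
rewrite -(sum_fibre e); apply: eq_bigr => i _.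
rewrite big_mkcond mulr_sumr /=; apply: eq_bigr => x _.
case: eqP => [<-|ei]; first by rewrite mulrA marg_cond.
by rewrite /cond; case: eqP => // _; rewrite !mul0r mulr0.
Qed.

Lemma sum_marg (F : I -> R) : \sum_x nu x * F (e x) = \sum_i marg e nu i * F i.
Proof.
rewrite -(sum_fibre e); apply: eq_bigr => i _; rewrite /marg mulr_suml.
by apply: eq_bigr => x /eqP ->.
Qed.

Lemma cond_self_neq0 x : nu x != 0 -> cond e nu (e x) x != 0.
Proof. by apply: contra_neq => h; rewrite -marg_cond h mulr0. Qed.

End OneMeasure.

Section Fibred.
Variables (e : T -> I) (w : I -> R) (mus : I -> T -> R) (f : I -> I -> T -> T).
Variable mu : T -> R.
Hypothesis fib : fibred e w mus f mu.

Lemma fibredE x : mu x = w (e x) * mus (e x) x.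
Proof.
case: fib => dw dmus emus -> _.
rewrite (bigD1 (e x))//= big1 ?addr0// => i ix.
have [->|wi] := eqVneq (w i) 0; first by rewrite mul0r.
have [->|mx] := eqVneq (mus i x) 0; first by rewrite mulr0.
by rewrite (emus _ _ wi mx) eqxx in ix.
Qed.

Variable nu : T -> R.
Hypotheses (dnu : distr nu) (numu : dominated nu mu).

Lemma marg_dominated : dominated (marg e nu) w.
Proof.
move=> i wi; apply: big1 => x /eqP xi; apply: numu.
by rewrite fibredE xi wi mul0r.
Qed.

Lemma marg_w i : marg e nu i != 0 -> w i != 0.
Proof. by apply: contra_neq => /marg_dominated. Qed.

Lemma cond_dominated i : marg e nu i != 0 -> dominated (cond e nu i) (mus i).
Proof.
move=> i0 x mx; apply: contra_eq mx => /cond_neq0 [ei nux].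
have : mu x != 0 by apply: contra_neq nux => /numu.
by rewrite fibredE ei mulf_eq0 negb_or => /andP[].
Qed.

Lemma rel_ent_chain : rel_ent nu mu = rel_ent (marg e nu) w
  + \sum_i marg e nu i * rel_ent (cond e nu i) (mus i).
Proof.
rewrite /rel_ent -(sum_cond e dnu (fun i x => ln (cond e nu i x / mus i x))).
rewrite -(sum_marg e nu (fun i => ln (marg e nu i / w i))).
rewrite -big_split /=; apply: eq_bigr => x _.
have [->|nux] := eqVneq (nu x) 0; first by rewrite !mul0r addr0.
rewrite -mulrDr; congr (_ * _).
have m0 := marg_neq0 e dnu nux; have w0 := marg_w m0.
have c0 := cond_self_neq0 e dnu nux.
have mus0 : mus (e x) x != 0.
  by apply: contra_neq c0; exact: cond_dominated.
case: fib => dw dmus _ _ _.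
rewrite -lnM; last 2 first.
- rewrite posrE divr_gt0// lt_neqAle eq_sym (m0, w0) distr_ge0//; exact: marg_distr.
- rewrite posrE divr_gt0// lt_neqAle eq_sym (c0, mus0)/= ?cond_ge0//.
  exact: (distr_ge0 (dmus _ w0)).
rewrite -[X in X / mu x](marg_cond e dnu) fibredE; congr ln; field; exact/andP.
Qed.

Variables (i j : I).
Hypotheses (wi : w i != 0) (mj : marg e nu j != 0).

Let fP : injective (f i j) /\ forall x, mus j (f i j x) = mus i x.
Proof. by case: fib => _ _ _ _; apply=> //; exact: marg_w. Qed.

(** The second conditional law lives in cell [j]. Read in cell [i] through [f i j], it is compared
    with the same reference [mus i] as the first one, with unchanged entropy, so that the two can be
    coupled inside one cell. *)
Lemma cond_transported_distr : distr (fun x => cond e nu j (f i j x)).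
Proof.
split=> [x|]; first exact: cond_ge0.
by rewrite (sum_bij (cond e nu j) fP.1) (cond_distr dnu mj).2.
Qed.

Lemma cond_transported_dominated : dominated (fun x => cond e nu j (f i j x)) (mus i).
Proof. by move=> x; rewrite -fP.2; exact: cond_dominated. Qed.

Lemma cond_transported_ent :
  rel_ent (fun x => cond e nu j (f i j x)) (mus i) = rel_ent (cond e nu j) (mus j).
Proof.
rewrite -[RHS](sum_bij _ fP.1); apply: eq_bigr => x _.
by rewrite fP.2.
Qed.

End Fibred.

(** A sum of a function of [i] and a function of [j] sees only the marginals of the coupling. This
    is what linearity in the entropies, for fixed [al] and [be], is used for. *)
Lemma transports_mean w1 w2 (ph : I -> I -> R) (al be : R) (h g : I -> R) :
  transports w1 w2 ph ->
  \sum_i w1 i * \sum_j ph i j * (al * h i + be * g j)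
    = al * \sum_i w1 i * h i + be * \sum_j w2 j * g j.
Proof.
move=> [dph ph2].
have -> : \sum_j w2 j * g j = \sum_i w1 i * \sum_j ph i j * g j.
  rewrite -(eq_bigr _ (fun j _ => congr1 (fun z => z * g j) (ph2 j))).
  rewrite (eq_bigr (fun j => \sum_i w1 i * (ph i j * g j))) => [|j _].
    by rewrite exchange_big; apply: eq_bigr => i _; rewrite mulr_sumr.
  by rewrite mulr_suml; apply: eq_bigr => i _; rewrite mulrA.
rewrite !mulr_sumr -big_split /=; apply: eq_bigr => i _.
have [->|i0] := eqVneq (w1 i) 0; first by rewrite !mul0r !mulr0 addr0.
rewrite (eq_bigr (fun j => ph i j * (al * h i) + be * (ph i j * g j))); last first.
  by move=> j _; ring.
rewrite big_split /= -mulr_suml (dph i i0).2 -mulr_sumr; ring.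
Qed.

Section Gluing.
Variables (e : T -> I) (w : I -> R) (mus : I -> T -> R) (f : I -> I -> T -> T).
Variable mu : T -> R.
Hypothesis fib : fibred e w mus f mu.
Variables (nu1 nu2 : T -> R).
Hypotheses (d1 : distr nu1) (d2 : distr nu2).
Hypotheses (ac1 : dominated nu1 mu) (ac2 : dominated nu2 mu).
Variable ph : I -> I -> R.
Hypothesis phP : transports (marg e nu1) (marg e nu2) ph.

(** Draw a target cell [j] by [ph], then a point [z] in the cell of [x] by [P], and carry [z] over
    to cell [j] by the matching. *)
Definition glue_kernel (P : I -> I -> T -> T -> R) x y : R :=
  \sum_j ph (e x) j * \sum_z P (e x) j x z * (f (e x) j z == y)%:R.

Lemma glue_sum P (F : T -> R) x :
  \sum_y glue_kernel P x y * F y =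
    \sum_j ph (e x) j * \sum_z P (e x) j x z * F (f (e x) j z).
Proof.
rewrite /glue_kernel (eq_bigr _ (fun y _ => mulr_suml _ _ _ _)) exchange_big /=.
apply: eq_bigr => j _.
rewrite (eq_bigr (fun y => ph (e x) j * (\sum_z P (e x) j x z * (f (e x) j z == y)%:R * F y))).
  rewrite -mulr_sumr exchange_big /=; congr (_ * _); apply: eq_bigr => z _.
  rewrite (bigD1 (f (e x) j z))//= eqxx mulr1 big1 ?addr0// => y.
  by rewrite eq_sym => /negbTE ->; rewrite mulr0 mul0r.
by move=> y _; rewrite -mulrA mulr_suml.
Qed.

(** The matching [f i j] is a bijection, so it undoes the pull-back in the second marginal of
    [P i j] and leaves the conditional law of [nu2] on cell [j]; averaging over [ph] restores
    [nu2]. *)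
Lemma glue_transports P :
  (forall i j, marg e nu1 i != 0 -> marg e nu2 j != 0 ->
    transports (cond e nu1 i) (fun x => cond e nu2 j (f i j x)) (P i j)) ->
  transports nu1 nu2 (glue_kernel P).
Proof.
move=> PP; have dm1 := marg_distr e d1.
have act i j : marg e nu1 i != 0 -> ph i j != 0 -> marg e nu2 j != 0.
  by move=> i0; exact: transports_neq0 phP dm1 i0.
split=> [x x0|y].
- have i0 := marg_neq0 e d1 x0.
  have c0 := cond_self_neq0 e d1 x0.
  have dph := phP.1 _ i0.
  split=> [y|].
    apply: sumr_ge0 => j _; have [->|p0] := eqVneq (ph (e x) j) 0; first by rewrite mul0r.
    have [dP _] := PP _ _ i0 (act _ _ i0 p0).
    rewrite mulr_ge0 ?distr_ge0// sumr_ge0// => z _.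
    by rewrite mulr_ge0// distr_ge0//; exact: dP.
  rewrite -(eq_bigr _ (fun y _ => mulr1 _)) (glue_sum P (fun=> 1)) -[RHS]dph.2.
  apply: eq_bigr => j _; have [->|p0] := eqVneq (ph (e x) j) 0; first by rewrite mul0r.
  have [dP _] := PP _ _ i0 (act _ _ i0 p0).
  by under eq_bigr do rewrite mulr1; rewrite (dP _ c0).2 mulr1.
- rewrite (sum_cond e d1 (fun i x => \sum_j ph i j * \sum_z P i j x z * (f i j z == y)%:R)).
  transitivity (\sum_i marg e nu1 i * \sum_j ph i j * cond e nu2 j y).
    apply: eq_bigr => i _; have [->|i0] := eqVneq (marg e nu1 i) 0; first by rewrite !mul0r.
    congr (_ * _).
    rewrite (eq_bigr (fun x => \sum_j ph i j *
        \sum_z cond e nu1 i x * P i j x z * (f i j z == y)%:R)); last first.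
      move=> x _; rewrite mulr_sumr; apply: eq_bigr => j _.
      rewrite mulrCA; congr (_ * _); rewrite mulr_sumr.
      by apply: eq_bigr => z _; rewrite mulrA.
    rewrite exchange_big /=; apply: eq_bigr => j _; rewrite -mulr_sumr.
    have [->|p0] := eqVneq (ph i j) 0; first by rewrite !mul0r.
    have j0 := act _ _ i0 p0; have [_ P2] := PP _ _ i0 j0; congr (_ * _).
    rewrite exchange_big /=.
    rewrite (eq_bigr (fun z => cond e nu2 j (f i j z) * (f i j z == y)%:R)); last first.
      by move=> z _; rewrite -mulr_suml P2.
    apply: sum_pick; case: (fib) => _ _ _ _ H.
    exact: (H _ _ (marg_w fib ac1 i0) (marg_w fib ac2 j0)).1.
  rewrite (eq_bigr (fun i => \sum_j marg e nu1 i * ph i j * cond e nu2 j y)); last first.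
    by move=> i _; rewrite mulr_sumr; apply: eq_bigr => j _; rewrite mulrA.
  rewrite exchange_big /= (eq_bigr (fun j => marg e nu2 j * cond e nu2 j y)); last first.
    by move=> j _; rewrite -mulr_suml phP.2.
  rewrite (bigD1 (e y))//= marg_cond// big1 ?addr0// => j jy.
  by rewrite /cond eq_sym (negbTE jy) !mul0r mulr0.
Qed.

(** Costs need comparing only at pairs of positive mass, for which [x] and [z] both lie in the
    component indexed by [e x]. *)
Lemma glue_le P (F : T -> R) (H : I -> T -> R) x :
  (forall i j, marg e nu1 i != 0 -> marg e nu2 j != 0 ->
    transports (cond e nu1 i) (fun x => cond e nu2 j (f i j x)) (P i j)) ->
  nu1 x != 0 ->
  (forall j z, w (e x) != 0 -> w j != 0 -> mus (e x) x != 0 -> mus (e x) z != 0 ->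
    F (f (e x) j z) <= H j z) ->
  \sum_y glue_kernel P x y * F y <= \sum_j ph (e x) j * \sum_z P (e x) j x z * H j z.
Proof.
move=> PP x0 FH; have i0 := marg_neq0 e d1 x0.
have c0 := cond_self_neq0 e d1 x0.
rewrite glue_sum; apply: ler_sum => j _.
have [->|p0] := eqVneq (ph (e x) j) 0; first by rewrite !mul0r.
have j0 := transports_neq0 phP (marg_distr e d1) i0 p0.
apply: ler_wpM2l; first exact: (distr_ge0 (phP.1 _ i0)).
apply: ler_sum => z _; have Pij := PP _ _ i0 j0.
have [->|P0] := eqVneq (P (e x) j x z) 0; first by rewrite !mul0r.
apply: ler_wpM2l; first exact: (distr_ge0 (Pij.1 _ c0)).
have wi := marg_w fib ac1 i0.
apply: FH => //; first exact: (marg_w fib ac2 j0).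
  by apply: contra_neq c0; exact: (cond_dominated fib ac1 i0).
have : cond e nu2 j (f (e x) j z) != 0.
  exact: (transports_neq0 Pij (cond_distr d1 i0) c0 P0).
by apply: contra_neq => h; exact: (cond_transported_dominated fib ac2 wi j0 h).
Qed.

(** Averages bounds known for each pair of cells; [h] and [g] stand for the conditional entropies,
    which [transports_mean] reassembles into the second half of the chain rule. *)
Lemma glue_bound (A : I -> I -> T -> R) (a : I -> R) (b al be : R) (h g : I -> R) :
  (forall i j, marg e nu1 i != 0 -> marg e nu2 j != 0 ->
    \sum_x cond e nu1 i x * A i j x <= a i + b * (al * h i + be * g j)) ->
  \sum_x nu1 x * \sum_j ph (e x) j * A (e x) j x <=
    \sum_i marg e nu1 i * a i
      + b * (al * \sum_i marg e nu1 i * h i + be * \sum_j marg e nu2 j * g j).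
Proof.
move=> Aab; have dm1 := marg_distr e d1.
rewrite (sum_cond e d1 (fun i x => \sum_j ph i j * A i j x)).
rewrite -(transports_mean al be h g phP) mulr_sumr -big_split /=.
apply: ler_sum => i _; have [->|i0] := eqVneq (marg e nu1 i) 0.
  by rewrite !(mul0r, mulr0, addr0).
rewrite mulrCA -mulrDr; apply: ler_wpM2l; first exact: distr_ge0.
rewrite -[a i]mul1r -(phP.1 _ i0).2 mulr_suml mulr_sumr -big_split /=.
under eq_bigr do rewrite mulr_sumr.
rewrite exchange_big /=; apply: ler_sum => j _.
have [->|p0] := eqVneq (ph i j) 0.
  by rewrite !(mul0r, mulr0, addr0) big1// => x _; rewrite mul0r mulr0.
under eq_bigr do rewrite mulrCA.
rewrite -mulr_sumr mulrCA -mulrDr.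
apply: ler_wpM2l; first exact: (distr_ge0 (phP.1 _ i0)).
by apply: Aab => //; exact: (transports_neq0 phP dm1 i0 p0).
Qed.

Variables (al be : R) (Q : I -> I -> (T -> R) -> (T -> T -> R) -> R -> Prop).

(** Packages the induction: [Q] is the bound given by the induction hypothesis inside a cell, and
    kernels are chosen for all pairs of cells at once. *)
Lemma glue_exists :
  (forall i j n1 n2, marg e nu1 i != 0 -> distr n1 -> distr n2 -> dominated n1 (mus i) ->
    dominated n2 (mus i) -> exists2 p, transports n1 n2 p
      & Q i j n1 p (al * rel_ent n1 (mus i) + be * rel_ent n2 (mus i))) ->
  exists P, transports nu1 nu2 (glue_kernel P) /\
    forall i j, marg e nu1 i != 0 -> marg e nu2 j != 0 ->
      transports (cond e nu1 i) (fun x => cond e nu2 j (f i j x)) (P i j) /\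
      Q i j (cond e nu1 i) (P i j) (al * rel_ent (cond e nu1 i) (mus i)
        + be * rel_ent (cond e nu2 j) (mus j)).
Proof.
move=> IH.
have /choice[P PP] (ij : I * I) : exists p,
    marg e nu1 ij.1 != 0 -> marg e nu2 ij.2 != 0 ->
    transports (cond e nu1 ij.1) (fun x => cond e nu2 ij.2 (f ij.1 ij.2 x)) p /\
    Q ij.1 ij.2 (cond e nu1 ij.1) p (al * rel_ent (cond e nu1 ij.1) (mus ij.1)
      + be * rel_ent (cond e nu2 ij.2) (mus ij.2)).
  case: ij => i j /=.
  have [i0|i0] := eqVneq (marg e nu1 i) 0; first by exists (fun _ _ => 0).
  have [j0|j0] := eqVneq (marg e nu2 j) 0; first by exists (fun _ _ => 0).
  have wi := marg_w fib ac1 i0.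
  have [p tp Qp] := IH i j _ _ i0 (cond_distr d1 i0) (cond_transported_distr fib d2 ac2 wi j0)
    (cond_dominated fib ac1 i0) (cond_transported_dominated fib ac2 wi j0).
  by exists p => _ _; split=> //; rewrite -(cond_transported_ent fib ac2 wi j0).
exists (fun i j => P (i, j)); split=> [|i j]; last exact: PP (i, j).
by apply: glue_transports => i j i0 j0; have [] := PP (i, j) i0 j0.
Qed.

End Gluing.

End Conditioning.

(** * Moment bounds along a chain of partitions *)

Section Chains.
Variables (R : realType) (T I : finType) (d : T -> T -> R) (c : R).
Hypotheses (d_ge0 : forall x y, 0 <= d x y) (d_refl : forall x, d x x = 0).
Implicit Types (mu nu : T -> R) (w : I -> R) (mus : I -> T -> R).

(** [K] counts the revelations that split the measure. It becomes the factor [Kn], since an index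
    with trivial orbit uses no constructor. *)
Inductive chain : nat -> (T -> R) -> Prop :=
| ChainPoint mu x0 of (forall x, x != x0 -> mu x = 0) : chain 0 mu
| ChainFibred K (e : T -> I) w mus f mu of fibred e w mus f mu &
    (forall i j x y, w i != 0 -> w j != 0 -> mus i x != 0 -> mus i y != 0 ->
      d x (f i j y) <= d x y + c * (i != j)%:R) &
    (forall i, w i != 0 -> chain K (mus i)) : chain K.+1 mu.

Lemma point_transports mu nu1 nu2 x0 : (forall x, x != x0 -> mu x = 0) ->
  distr nu1 -> distr nu2 -> dominated nu1 mu -> dominated nu2 mu ->
  transports nu1 nu2 (fun x y => (x == y)%:R).
Proof.
move=> mu0 d1 d2 ac1 ac2.
have pt nu : distr nu -> dominated nu mu -> forall x, nu x = (x == x0)%:R.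
  move=> dnu ac x; have nu0 y : y != x0 -> nu y = 0 by move/mu0/ac.
  have [->|/nu0 //] := eqVneq x x0.
  by rewrite -dnu.2 (bigD1 x0)//= big1 ?addr0.
split=> [x _|y].
  split=> [y|]; first exact: ler0n.
  by rewrite (bigD1 x)//= eqxx big1 ?addr0// => y; rewrite eq_sym => /negbTE ->.
rewrite (pt _ d2 ac2) -(pt _ d1 ac1) (bigD1 y)//= eqxx mulr1 big1 ?addr0// => x /negbTE ->.
by rewrite mulr0.
Qed.

Variables (al be : R).
Hypotheses (al0 : 0 < al) (be0 : 0 < be) (albe : al^-1 + be^-1 = 1).

Section Step.
Variables (e : T -> I) (w : I -> R) (mus : I -> T -> R) (f : I -> I -> T -> T).
Variable mu : T -> R.
Hypothesis fib : fibred e w mus f mu.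
Hypothesis df : forall i j x y, w i != 0 -> w j != 0 -> mus i x != 0 ->
  mus i y != 0 -> d x (f i j y) <= d x y + c * (i != j)%:R.
Variables (nu1 nu2 : T -> R).
Hypotheses (d1 : distr nu1) (d2 : distr nu2).
Hypotheses (ac1 : dominated nu1 mu) (ac2 : dominated nu2 mu).
Variable ph : I -> I -> R.
Hypothesis phP : transports (marg e nu1) (marg e nu2) ph.
Hypothesis phq : forall i, marg e nu1 i != 0 ->
  \sum_j ph i j * (i != j)%:R = moverate (marg e nu1) (marg e nu2) i.

(** The matching adds at most [c], and only when the cell changes, which has probability
    [moverate]. *)
Lemma glue_dist_le P x :
  (forall i j, marg e nu1 i != 0 -> marg e nu2 j != 0 ->
    transports (cond e nu1 i) (fun x => cond e nu2 j (f i j x)) (P i j)) ->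
  nu1 x != 0 ->
  \sum_y glue_kernel e f ph P x y * d x y <=
    c * moverate (marg e nu1) (marg e nu2) (e x)
      + \sum_j ph (e x) j * \sum_z P (e x) j x z * d x z.
Proof.
move=> PP x0; have i0 := marg_neq0 e d1 x0; have c0 := cond_self_neq0 e d1 x0.
apply: le_trans (glue_le fib d1 ac1 ac2 phP PP x0 (F := d x)
  (H := fun j z => d x z + c * (e x != j)%:R) _) _.
  by move=> j z wi wj m1 m2; exact: df.
rewrite -phq// mulr_sumr -big_split /=; apply: ler_sum => j _.
have [->|p0] := eqVneq (ph (e x) j) 0; first by rewrite !(mul0r, mulr0, addr0).
have j0 := transports_neq0 phP (marg_distr e d1) i0 p0.
under eq_bigr do rewrite mulrDr.
rewrite big_split /= -mulr_suml ((PP _ _ i0 j0).1 _ c0).2 mul1r.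
by rewrite mulrDr; lra.
Qed.

End Step.

(** Pinsker bounds the square of the mean displacement of one step; [lam] linearises this square so
    that the [K] steps add up. It is optimised only after the last step. *)
Lemma chain_W1 K mu (lam : R) nu1 nu2 : 0 < lam -> chain K mu ->
  distr mu -> distr nu1 -> distr nu2 -> dominated nu1 mu -> dominated nu2 mu ->
  exists2 p, transports nu1 nu2 p & \sum_x nu1 x * \sum_y p x y * d x y <=
    lam * K%:R / 2 + c ^+ 2 / (4 * lam) * (al * rel_ent nu1 mu + be * rel_ent nu2 mu).
Proof.
move=> lam0 ch; elim: ch nu1 nu2 => {K mu} [mu x0 mu0|K e w mus f mu fib df _ IH]
  nu1 nu2 dmu d1 d2 ac1 ac2.
  have tp := point_transports mu0 d1 d2 ac1 ac2.
  exists (fun x y => (x == y)%:R) => //.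
  rewrite big1 => [|x _]; last first.
    rewrite big1 ?mulr0// => y _; have [->|_] := eqVneq x y; last by rewrite mul0r.
    by rewrite d_refl mulr0.
  rewrite mulr0 mul0r add0r mulr_ge0//.
    by rewrite divr_ge0 ?sqr_ge0// mulr_ge0// ltW.
  by rewrite addr_ge0// mulr_ge0 ?rel_ent_ge0// ltW.
have dm1 := marg_distr e d1; have dm2 := marg_distr e d2.
have am1 := marg_dominated fib ac1; have am2 := marg_dominated fib ac2.
case: (fib) => dw dmus _ _ _.
have [ph phP phq] := optimal_kernel dm1 dm2.
have PE := pinsker_base dm1 dm2 dw am1 am2 al0 be0 albe.
pose Q (i j : I) (n1 : T -> R) (p : T -> T -> R) X : Prop :=
  \sum_x n1 x * \sum_y p x y * d x y <= lam * K%:R / 2 + c ^+ 2 / (4 * lam) * X.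
have [|P [tP PP]] := glue_exists (al := al) (be := be) (Q := Q) fib d1 d2 ac1 ac2 phP.
  move=> i j n1 n2 i0 dn1 dn2 an1 an2; have wi := marg_w fib ac1 i0.
  by have [p tp pQ] := IH i wi n1 n2 (dmus _ wi) dn1 dn2 an1 an2; exists p.
exists (glue_kernel e f ph P) => //.
have tPij i j i0 j0 := (PP i j i0 j0).1.
pose q i := moverate (marg e nu1) (marg e nu2) i.
apply: (@le_trans _ _ (\sum_x nu1 x * (c * q (e x))
    + \sum_x nu1 x * \sum_j ph (e x) j * \sum_z P (e x) j x z * d x z)).
  rewrite -big_split /=; apply: ler_sum => x _; rewrite -mulrDr.
  have [->|x0] := eqVneq (nu1 x) 0; first by rewrite !mul0r.
  by apply: ler_wpM2l; [exact: distr_ge0|exact: (glue_dist_le fib)].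
rewrite (sum_marg e nu1 (fun i => c * q i)).
have := glue_bound d1 phP (fun i j i0 j0 => (PP i j i0 j0).2).
rewrite -mulr_suml dm1.2 mul1r => hB.
apply: le_trans (lerD (lexx _) hB) _; rewrite !(rel_ent_chain fib)//.
have -> : \sum_i marg e nu1 i * (c * q i) = c * \sum_i marg e nu1 i * q i.
  by rewrite mulr_sumr; apply: eq_bigr => i _; rewrite mulrCA.
set t := \sum_i marg e nu1 i * q i; rewrite -/t in PE.
set A := al * _ + _ in PE.
(* Arithmetic-geometric inequality for [c * t] with weight [lam], followed by Pinsker's bound [PE]
   on [t ^+ 2]. *)
have hA : c * t <= lam / 2 + c ^+ 2 / (4 * lam) * A.
  apply: (@le_trans _ _ (lam / 2 + c ^+ 2 * t ^+ 2 / (2 * lam))).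
    rewrite -subr_ge0 (_ : _ - _ = (lam - c * t) ^+ 2 / (2 * lam)).
      by rewrite divr_ge0 ?sqr_ge0// mulr_ge0// ltW.
    by field; rewrite gt_eqF.
  rewrite lerD2l ler_pdivrMr ?mulr_gt0//.
  have := ler_wpM2l (sqr_ge0 c) PE.
  rewrite (_ : c ^+ 2 / (4 * lam) * A * (2 * lam) = c ^+ 2 * (A / 2)) => [//|].
  by field; rewrite gt_eqF.
rewrite -addn1 natrD; apply: le_trans (lerD hA (lexx _)) _.
by rewrite le_eqVlt /A; apply/orP; left; apply/eqP; field; rewrite gt_eqF.
Qed.

Lemma chain_T2 K mu nu1 nu2 : chain K mu ->
  distr mu -> distr nu1 -> distr nu2 -> dominated nu1 mu -> dominated nu2 mu ->
  exists2 p, transports nu1 nu2 p & \sum_x nu1 x * (\sum_y p x y * d x y) ^+ 2 <=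
    2 * c ^+ 2 * K%:R * (al * rel_ent nu1 mu + be * rel_ent nu2 mu).
Proof.
move=> ch; elim: ch nu1 nu2 => {K mu} [mu x0 mu0|K e w mus f mu fib df _ IH]
  nu1 nu2 dmu d1 d2 ac1 ac2.
  have tp := point_transports mu0 d1 d2 ac1 ac2.
  exists (fun x y => (x == y)%:R) => //.
  rewrite big1 => [|x _]; first by rewrite mulr0 mul0r.
  rewrite big1 ?expr0n ?mulr0// => y _; have [->|_] := eqVneq x y; last by rewrite mul0r.
  by rewrite d_refl mulr0.
have dm1 := marg_distr e d1; have dm2 := marg_distr e d2.
have am1 := marg_dominated fib ac1; have am2 := marg_dominated fib ac2.
case: (fib) => dw dmus _ _ _.
have [ph phP phq] := optimal_kernel dm1 dm2.
have ME := marton_base dm1 dm2 dw am1 am2 al0 be0 albe.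
pose Q (i j : I) (n1 : T -> R) (p : T -> T -> R) X : Prop :=
  \sum_x n1 x * (\sum_y p x y * d x y) ^+ 2 <= 0 + 2 * c ^+ 2 * K%:R * X.
have [|P [tP PP]] := glue_exists (al := al) (be := be) (Q := Q) fib d1 d2 ac1 ac2 phP.
  move=> i j n1 n2 i0 dn1 dn2 an1 an2; have wi := marg_w fib ac1 i0.
  have [p tp pQ] := IH i wi n1 n2 (dmus _ wi) dn1 dn2 an1 an2.
  by exists p => //; rewrite /Q add0r.
exists (glue_kernel e f ph P) => //.
have tPij i j i0 j0 := (PP i j i0 j0).1.
pose q i := moverate (marg e nu1) (marg e nu2) i.
(* [K + 1] and [r] are conjugate exponents, and [r * K = K + 1] makes the first step and the
   remaining ones count alike. For [K = 0] the quotient is 0 by convention, so the remainder [y] has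
   to vanish. *)
pose r : R := K.+1%:R / K%:R.
have sq (x y : R) : (K = 0%N -> y = 0) -> (x + y) ^+ 2 <= K.+1%:R * x ^+ 2 + r * y ^+ 2.
  rewrite /r; case: (K) => [/(_ erefl) ->|k _]; first by rewrite !addr0 expr0n mulr0 addr0 mul1r.
  apply: sqrD_conj_le; rewrite ?divr_gt0 ?ltr0n//.
  by rewrite invf_div -[X in X + _]mul1r -mulrDl nat1r divff ?pnatr_eq0.
have r0 : 0 <= r by rewrite divr_ge0.
apply: (@le_trans _ _ (\sum_x nu1 x * (K.+1%:R * (c * q (e x)) ^+ 2)
    + r * \sum_x nu1 x * \sum_j ph (e x) j * (\sum_z P (e x) j x z * d x z) ^+ 2)).
  rewrite mulr_sumr -big_split /=; apply: ler_sum => x _.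
  rewrite [r * _]mulrCA -mulrDr.
  have [->|x0] := eqVneq (nu1 x) 0; first by rewrite !mul0r.
  have i0 := marg_neq0 e d1 x0; have c0 := cond_self_neq0 e d1 x0.
  have j0 j p0 := transports_neq0 phP dm1 i0 (j := j) p0.
  apply: ler_wpM2l; first exact: distr_ge0.
  apply: (@le_trans _ _ ((c * q (e x) + \sum_j ph (e x) j * \sum_z P (e x) j x z * d x z) ^+ 2)).
    have G0 : 0 <= \sum_y glue_kernel e f ph P x y * d x y.
      by apply: sumr_ge0 => y _; rewrite mulr_ge0//; exact: (distr_ge0 (tP.1 _ x0)).
    have Gle := glue_dist_le fib df d1 ac1 ac2 phP phq tPij x0.
    by rewrite ler_sqr ?nnegrE//; exact: le_trans G0 Gle.
  (* For [K = 0] the induction hypothesis bounds a sum of nonnegative terms by 0, hence the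
     remainder vanishes at every point of positive mass. *)
  apply: le_trans (sq _ _ _) _ => [K0|].
    apply: big1 => j _; have [->|p0] := eqVneq (ph (e x) j) 0; first by rewrite mul0r.
    have := (PP _ _ i0 (j0 _ p0)).2; rewrite /Q K0 mulr0 mul0r addr0.
    rewrite (bigD1 x)//= => h; apply/eqP; rewrite mulf_eq0 (negbTE p0) /=.
    rewrite -sqrf_eq0; apply: contraTT h => h; rewrite -ltNge ltr_pwDl//.
      rewrite mulr_gt0// lt_neqAle eq_sym ?c0 ?h ?sqr_ge0 ?cond_ge0//.
    by apply: sumr_ge0 => y _; rewrite mulr_ge0 ?sqr_ge0 ?cond_ge0.
  rewrite lerD2l; apply: ler_wpM2l => //.
  exact: (jensen_sqr (fun j => \sum_z P (e x) j x z * d x z) (phP.1 _ i0)).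
rewrite (sum_marg e nu1 (fun i => K.+1%:R * (c * q i) ^+ 2)).
have := glue_bound d1 phP (fun i j i0 j0 => (PP i j i0 j0).2).
rewrite -mulr_suml mulr0 add0r => hB.
apply: le_trans (lerD (lexx _) (ler_wpM2l r0 hB)) _; rewrite !(rel_ent_chain fib)//.
have -> : \sum_i marg e nu1 i * (K.+1%:R * (c * q i) ^+ 2)
    = K.+1%:R * c ^+ 2 * \sum_i marg e nu1 i * q i ^+ 2.
  by rewrite mulr_sumr; apply: eq_bigr => i _; ring.
set A := al * _ + _ in ME.
set B := al * \sum_i _ + _ in hB *.
have -> : al * (rel_ent (marg e nu1) w + \sum_i marg e nu1 i * rel_ent (cond e nu1 i) (mus i))
    + be * (rel_ent (marg e nu2) w + \sum_i marg e nu2 i * rel_ent (cond e nu2 i) (mus i))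
    = A + B by rewrite /A /B; ring.
have Kc : 0 <= K.+1%:R * c ^+ 2 by rewrite mulr_ge0 ?sqr_ge0.
have := ler_wpM2l Kc ME; rewrite -/q => hA.
suff : r * (2 * c ^+ 2 * K%:R * B) <= K.+1%:R * (2 * c ^+ 2 * B) by lra.
have [K0|Kn0] := eqVneq K 0%N; last first.
  by rewrite le_eqVlt /r; apply/orP; left; apply/eqP; field; rewrite pnatr_eq0.
have mean_ge0 nu : distr nu -> dominated nu mu ->
    0 <= \sum_i marg e nu i * rel_ent (cond e nu i) (mus i).
  move=> dnu ac; apply: sumr_ge0 => i _.
  have [->|i0] := eqVneq (marg e nu i) 0; first by rewrite mul0r.
  apply: mulr_ge0; first exact: (distr_ge0 (marg_distr e dnu)).
  apply: rel_ent_ge0; first exact: cond_distr.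
    exact: dmus (marg_w fib ac i0).
  exact: (cond_dominated fib ac i0).
rewrite /r K0 invr0 !(mulr0, mul0r) mul1r; apply: mulr_ge0.
  by rewrite mulr_ge0 ?sqr_ge0.
by rewrite /B addr_ge0// mulr_ge0 ?mean_ge0 ?(ltW al0) ?(ltW be0).
Qed.

End Chains.

(** * The perturbed transport inequality *)

Section Coordinates.
Variable n : nat.
Implicit Types (s r t : 'S_n).

(* [orient true s] is read position-wise and [orient false s] value-wise. *)
Definition orient (b : bool) s : 'S_n := if b then s else s^-1%g.

(** Multiplication on the side on which [r] acts on the images of the reading [orient b s], for
    either orientation. *)
Definition lact (b : bool) r s : 'S_n := if b then (s * r)%g else (r^-1 * s)%g.

Lemma orient_lact b r s : orient b (lact b r s) = (orient b s * r)%g.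
Proof. by case: b => //=; rewrite invMg invgK. Qed.

Lemma orientN b s : orient (~~ b) s = (orient b s)^-1%g.
Proof. by case: b => //=; rewrite invgK. Qed.

Lemma lact_inj b r : injective (lact b r).
Proof. by case: b => s t /=; [exact: mulIg|exact: mulgI]. Qed.

Lemma orient_orient b s : orient b (orient b s) = s.
Proof. by case: b => //=; rewrite invgK. Qed.

Lemma orient_bij b : bijective (orient b).
Proof. by exists (orient b); exact: orient_orient. Qed.

End Coordinates.

Section Perturbed.
Variables (R : realType) (n L : nat).
Implicit Types (mu nu : 'S_n -> R) (u : 'I_n -> R).

(* Revealing the image of any single position (for [b = true]; of any single
   value for [b = false]) splits [mu] into pieces matched by multiplications by
   permutations of degree at most [L]. Such a multiplication on one side
   displaces a fixed set of points on the other side, so the next coordinate to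
   be revealed is read with the opposite orientation. *)
Fixpoint exposable (d : nat) (b : bool) mu : Prop :=
  match d with
  | 0 => exists s0, forall s, s != s0 -> mu s = 0
  | d'.+1 => forall m : 'I_n,
      (exists i, forall s, mu s != 0 -> orient b s m = i) \/
      (exists w mus (r : 'I_n -> 'I_n -> 'S_n),
        [/\ fibred (fun s => orient b s m) w mus (fun i j => lact b (r i j)) mu,
            forall i, r i i = 1%g,
            forall i j, w i != 0 -> w j != 0 -> i != j ->
              r i j i = j /\ (pdeg (r i j) <= L)%N
          & forall i, w i != 0 -> exposable d' (~~ b) (mus i)])
  end.

(** With [u = 0] and [b = true] this is the cost of the third transport problem; [u k] is an extra
    displacement probability charged to coordinate [k] by earlier revelations. *)
Definition shift_cost b u nu (p : 'S_n -> 'S_n -> R) : R :=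
  \sum_s nu s * \sum_k (\sum_t p s t * (orient b s k != orient b t k)%:R + u k) ^+ 2.

Definition shift_const : R := 2 * (L%:R - 1) ^+ 2 + 2.

Variables (al be : R).
Hypotheses (al0 : 0 < al) (be0 : 0 < be) (albe : al^-1 + be^-1 = 1).

Section Step.
Variables (b : bool) (m : 'I_n) (U : R) (mu nu1 nu2 : 'S_n -> R).
Variables (w : 'I_n -> R) (mus : 'I_n -> 'S_n -> R) (r : 'I_n -> 'I_n -> 'S_n).
Let e (s : 'S_n) := orient b s m.
Let f i j := lact b (r i j).
Hypothesis U0 : 0 <= U.
Hypothesis fib : fibred e w mus f mu.
Hypothesis rii : forall i, r i i = 1%g.
Hypothesis rij : forall i j, w i != 0 -> w j != 0 -> i != j ->
  r i j i = j /\ (pdeg (r i j) <= L)%N.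
Hypotheses (d1 : distr nu1) (d2 : distr nu2).
Hypotheses (ac1 : dominated nu1 mu) (ac2 : dominated nu2 mu).
Hypothesis IH : forall i u n1 n2, w i != 0 -> (forall a, 0 <= u a) ->
  distr n1 -> distr n2 -> dominated n1 (mus i) -> dominated n2 (mus i) ->
  exists2 p, transports n1 n2 p & shift_cost (~~ b) u n1 p <=
    2 * (\sum_a u a) ^+ 2
    + 2 * shift_const * (al * rel_ent n1 (mus i) + be * rel_ent n2 (mus i)).

(** The point [i] is left out because it is the image of the revealed position [m], whose cost is
    counted separately. Hence [L - 1] instead of [L] in [moved_sum]. *)
Let moved i j (a : 'I_n) : R := ((a \in psupp (r i j)) && (a != i))%:R.

Let moved_sum i j : w i != 0 -> w j != 0 ->
  \sum_a moved i j a <= (L%:R - 1) * (i != j)%:R.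
Proof.
move=> wi wj; have [<-|ij] := eqVneq i j.
  rewrite mulr0 big1// => a _.
  by rewrite /moved rii inE perm1 eqxx.
have [ri rL] := rij wi wj ij; rewrite mulr1.
rewrite -natr_sum -big_mkcond /= sum1_card.
have -> : #|[pred a | (a \in psupp (r i j)) && (a != i)]| = #|psupp (r i j) :\ i|.
  by apply: eq_card => a; rewrite !inE andbC.
have iP : i \in psupp (r i j) by rewrite inE ri eq_sym.
rewrite lerBrDr natr1 ler_nat.
by move: rL; rewrite /pdeg (cardsD1 i) iP.
Qed.

Lemma shift_step : exists2 p, transports nu1 nu2 p
  & shift_cost b (fun k => U * (k == m)%:R) nu1 p <=
    2 * U ^+ 2 + 2 * shift_const * (al * rel_ent nu1 mu + be * rel_ent nu2 mu).
Proof.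
have dm1 := marg_distr e d1; have dm2 := marg_distr e d2.
have am1 := marg_dominated fib ac1; have am2 := marg_dominated fib ac2.
case: (fib) => dw dmus emus _ _.
have [ph phP phq] := optimal_kernel dm1 dm2.
have ME := marton_base dm1 dm2 dw am1 am2 al0 be0 albe.
pose q i := moverate (marg e nu1) (marg e nu2) i.
(* The perturbation handed to the cells: the probability, given cell [i], that the matching
   displaces [a]. *)
pose ub i a : R := \sum_j ph i j * moved i j a.
have ub0 i a : marg e nu1 i != 0 -> 0 <= ub i a.
  move=> i0; apply: sumr_ge0 => j _; rewrite mulr_ge0 ?ler0n//.
  exact: (distr_ge0 (phP.1 _ i0)).
have ubq i : marg e nu1 i != 0 -> \sum_a ub i a <= (L%:R - 1) * q i.
  move=> i0; rewrite /ub exchange_big /= /q -phq// mulr_sumr.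
  apply: ler_sum => j _; rewrite -mulr_sumr mulrCA.
  have [->|p0] := eqVneq (ph i j) 0; first by rewrite !mul0r.
  apply: ler_wpM2l; first exact: (distr_ge0 (phP.1 _ i0)).
  apply: moved_sum; first exact: (marg_w fib ac1 i0).
  exact: (marg_w fib ac2 (transports_neq0 phP dm1 i0 p0)).
pose Q (i j : 'I_n) n1 p X : Prop := shift_cost (~~ b) (ub i) n1 p <=
  2 * (\sum_a ub i a) ^+ 2 + 2 * shift_const * X.
have [|P [tP PP]] := glue_exists (al := al) (be := be) (Q := Q) fib d1 d2 ac1 ac2 phP.
  move=> i j n1 n2 i0 dn1 dn2 an1 an2.
  apply: IH => //; first exact: (marg_w fib ac1 i0).
  by move=> a; exact: ub0.
exists (glue_kernel e f ph P) => //.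
have tPij i j i0 j0 := (PP i j i0 j0).1.
pose G i j (s : 'S_n) a : R :=
  \sum_z P i j s z * (orient (~~ b) s a != orient (~~ b) z a)%:R.
(* The first sum bounds the contribution of [m], the second that of the other positions, read as
   values in the opposite orientation. *)
apply: (@le_trans _ _ (\sum_s nu1 s * (2 * q (e s) ^+ 2 + 2 * U ^+ 2)
    + \sum_s nu1 s * \sum_j ph (e s) j * \sum_a (G (e s) j s a + ub (e s) a) ^+ 2)).
  rewrite -big_split /=; apply: ler_sum => s _; rewrite -mulrDr.
  have [->|s0] := eqVneq (nu1 s) 0; first by rewrite !mul0r.
  apply: ler_wpM2l; first exact: distr_ge0.
  have i0 := marg_neq0 e d1 s0; have c0 := cond_self_neq0 e d1 s0.
  have j0 j p0 := transports_neq0 phP dm1 i0 (j := j) p0.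
  have wi := marg_w fib ac1 i0.
  set i := e s in i0 c0 j0 wi *.
  have phd := phP.1 _ i0.
  have v0 k : 0 <= \sum_t glue_kernel e f ph P s t * (orient b s k != orient b t k)%:R.
    by apply: sumr_ge0 => t _; rewrite mulr_ge0 ?ler0n//; exact: (distr_ge0 (tP.1 _ s0)).
  rewrite (bigD1 m)//= eqxx mulr1; apply: lerD.
    (* At [m] a disagreement forces a change of cell, so its probability is at most [q i]. *)
    have q_le : \sum_t glue_kernel e f ph P s t * (orient b s m != orient b t m)%:R <= q i.
      apply: le_trans (glue_le fib d1 ac1 ac2 phP tPij s0
        (F := fun t => (orient b s m != orient b t m)%:R)
        (H := fun j z => (i != j)%:R) _) _.
        move=> j z _ wj ms mz; rewrite orient_lact permM ler_nat.
        have -> : orient b z m = i by exact: emus mz.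
        rewrite -/(e s) -/i; have [<-|ij] := eqVneq i j; first by rewrite rii perm1 eqxx.
        exact: leq_b1.
      rewrite /q -phq//; apply: ler_sum => j _; rewrite -mulr_suml.
      have [->|p0] := eqVneq (ph i j) 0; first by rewrite !mul0r.
      by rewrite ((tPij _ _ i0 (j0 _ p0)).1 _ c0).2 mul1r.
    have q0 := moverate_ge0 (marg e nu2) dm1 i.
    apply: (@le_trans _ _ ((q i + U) ^+ 2)).
      by rewrite ler_sqr ?nnegrE ?addr_ge0// lerD2r.
    rewrite -subr_ge0 (_ : _ - _ = (q i - U) ^+ 2) ?sqr_ge0//; ring.
  apply: (@le_trans _ _ (\sum_k \sum_j ph i j *
      (G i j s (orient b s k) + ub i (orient b s k)) ^+ 2)).
    rewrite [leRHS](bigD1 m)//= -[leLHS]add0r; apply: lerD.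
      by apply: sumr_ge0 => j _; rewrite mulr_ge0 ?sqr_ge0//; exact: (distr_ge0 phd).
    apply: ler_sum => k km; rewrite (negbTE km) mulr0 addr0.
    (* The position [k] is traded for the value [a] that [s] takes there: if [z] takes [a] at [k]
       too and the matching fixes [a], the images of [k] still agree. *)
    set a := orient b s k.
    apply: le_trans (jensen_sqr (fun j => G i j s a + ub i a) phd).
    rewrite ler_sqr ?nnegrE ?v0//.
      apply: le_trans (glue_le fib d1 ac1 ac2 phP tPij s0
        (F := fun t => (orient b s k != orient b t k)%:R)
        (H := fun j z => (orient (~~ b) s a != orient (~~ b) z a)%:R + moved i j a) _) _.
        move=> j z _ wj ms mz; rewrite orient_lact permM -natrD ler_nat -/a -/i.
        rewrite !orientN {1}/a permK.
        have ai : a != i by rewrite /a /i /e (inj_eq perm_inj).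
        rewrite ai andbT.
        have [ka|ka] := eqVneq k ((orient b z)^-1%g a); last first.
          exact: leq_trans (leq_b1 _) (leq_addr _ _).
        by rewrite add0n {2}ka permKV inE eq_sym.
      have -> : \sum_j ph i j * (G i j s a + ub i a) = \sum_j ph i j * G i j s a + ub i a.
        by under eq_bigr do rewrite mulrDr; rewrite big_split /= -mulr_suml phd.2 mul1r.
      rewrite -big_split /=; apply: ler_sum => j _; rewrite -mulrDr.
      have [->|p0] := eqVneq (ph i j) 0; first by rewrite !mul0r.
      under eq_bigr do rewrite mulrDr.
      by rewrite big_split /= -mulr_suml ((tPij _ _ i0 (j0 _ p0)).1 _ c0).2 mul1r.
    apply: sumr_ge0 => j _.
    have [->|p0] := eqVneq (ph i j) 0; first by rewrite mul0r.
    rewrite mulr_ge0 ?(distr_ge0 phd)// addr_ge0 ?ub0// sumr_ge0// => z _.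
    by rewrite mulr_ge0 ?ler0n//; exact: (distr_ge0 ((tPij _ _ i0 (j0 _ p0)).1 _ c0)).
  rewrite exchange_big /=; apply: ler_sum => j _; rewrite -mulr_sumr.
  apply: ler_wpM2l; first exact: (distr_ge0 phd).
  (* Positions and values are exchanged through the permutation [orient b s] itself. *)
  by rewrite [leRHS](reindex_inj (@perm_inj _ (orient b s))).
rewrite (sum_marg e nu1 (fun i => 2 * q i ^+ 2 + 2 * U ^+ 2)).
have := glue_bound d1 phP (fun i j i0 j0 => (PP i j i0 j0).2).
move=> hB; apply: le_trans (lerD (lexx _) hB) _; rewrite !(rel_ent_chain fib)//.
(* The terms [2 * q i ^+ 2] from position [m] and [2 * (L - 1) ^+ 2 * q i ^+ 2] from the
   perturbation add up to [shift_const * q i ^+ 2]. *)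
have hq : \sum_i marg e nu1 i * (2 * q i ^+ 2 + 2 * U ^+ 2)
    + \sum_i marg e nu1 i * (2 * (\sum_a ub i a) ^+ 2) <=
    2 * U ^+ 2 + shift_const * \sum_i marg e nu1 i * q i ^+ 2.
  have UE : 2 * U ^+ 2 = \sum_i marg e nu1 i * (2 * U ^+ 2).
    by rewrite -mulr_suml dm1.2 mul1r.
  rewrite [2 * U ^+ 2 in leRHS]UE mulr_sumr -!big_split /=.
  apply: ler_sum => i _.
  have [->|i0] := eqVneq (marg e nu1 i) 0; first by rewrite !(mul0r, mulr0, addr0).
  rewrite [shift_const * _]mulrCA -!mulrDr.
  apply: ler_wpM2l; first exact: (distr_ge0 dm1).
  have s0 : 0 <= \sum_a ub i a by apply: sumr_ge0 => a _; exact: ub0.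
  have : (\sum_a ub i a) ^+ 2 <= ((L%:R - 1) * q i) ^+ 2.
    by rewrite ler_sqr ?nnegrE ?ubq//; exact: le_trans s0 (ubq _ i0).
  rewrite exprMn /shift_const; lra.
have c0 : 0 <= shift_const by rewrite /shift_const addr_ge0// mulr_ge0// sqr_ge0.
have hA := ler_wpM2l c0 ME; rewrite -/q in hA.
rewrite addrA; apply: le_trans (lerD hq (lexx _)) _; lra.
Qed.

End Step.
Lemma sum_sqr_le u : (forall k, 0 <= u k) -> \sum_k u k ^+ 2 <= (\sum_k u k) ^+ 2.
Proof.
move=> u0; rewrite [leRHS]expr2 mulr_suml; apply: ler_sum => k _.
rewrite expr2; apply: ler_wpM2l => //.
by rewrite (bigD1 k)//= lerDl sumr_ge0.
Qed.

Lemma shift_cost_point b u nu : distr nu ->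
  shift_cost b u nu (fun s t => (s == t)%:R) = \sum_k u k ^+ 2.
Proof.
move=> dnu; rewrite -[RHS]mul1r -dnu.2 mulr_suml; apply: eq_bigr => s _.
congr (_ * _); apply: eq_bigr => k _; rewrite big1 ?add0r// => t _.
by have [->|_] := eqVneq s t; rewrite ?eqxx ?mulr0 ?mul0r.
Qed.

Lemma transports_mix (w : 'I_n -> R) (p : 'I_n -> 'S_n -> 'S_n -> R) nu1 nu2 :
  distr w -> (forall m, transports nu1 nu2 (p m)) ->
  transports nu1 nu2 (fun s t => \sum_m w m * p m s t).
Proof.
move=> dw tp; split=> [s s0|t].
  split=> [t|].
    by apply: sumr_ge0 => m _; rewrite mulr_ge0 ?(distr_ge0 dw)// (distr_ge0 ((tp m).1 _ s0)).
  rewrite exchange_big /= -dw.2; apply: eq_bigr => m _.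
  by rewrite -mulr_sumr ((tp m).1 _ s0).2 mulr1.
transitivity (\sum_m w m * nu2 t); last by rewrite -mulr_suml dw.2 mul1r.
under eq_bigr do rewrite mulr_sumr.
rewrite exchange_big /=; apply: eq_bigr => m _.
by rewrite -(tp m).2 mulr_sumr; apply: eq_bigr => s _; rewrite mulrCA.
Qed.

(* The perturbation [u] is the convex combination of its concentrations
   [(\sum u) 1_m], and revealing coordinate [m] first makes the [m]-th one
   harmless. *)
Lemma shift_cost_mix b u (p : 'I_n -> 'S_n -> 'S_n -> R) nu1 nu2 C :
  distr nu1 -> (forall k, 0 <= u k) -> \sum_k u k != 0 ->
  (forall m, transports nu1 nu2 (p m) /\
    shift_cost b (fun k => (\sum_a u a) * (k == m)%:R) nu1 (p m) <= C) ->
  exists2 q, transports nu1 nu2 q & shift_cost b u nu1 q <= C.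
Proof.
set U := \sum_k u k => d1 u0 Un0 pC.
have Ugt0 : 0 < U by rewrite lt_neqAle eq_sym Un0 sumr_ge0.
pose w m := u m / U.
have dw : distr w.
  by split=> [m|]; [rewrite divr_ge0// ltW|rewrite -mulr_suml divff].
exists (fun s t => \sum_m w m * p m s t).
  by apply: transports_mix => // m; exact: (pC m).1.
apply: (@le_trans _ _ (\sum_m w m * shift_cost b (fun k => (\sum_a u a) * (k == m)%:R) nu1 (p m))).
  rewrite /shift_cost; under [leRHS]eq_bigr do rewrite mulr_sumr.
  rewrite [leRHS]exchange_big /=; apply: ler_sum => s _.
  under [leRHS]eq_bigr do rewrite mulrCA.
  rewrite -mulr_sumr; apply: ler_wpM2l; first exact: (distr_ge0 d1).
  under [leRHS]eq_bigr do rewrite mulr_sumr.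
  rewrite [leRHS]exchange_big /=; apply: ler_sum => k _.
  set F := fun t : 'S_n => (orient b s k != orient b t k)%:R : R.
  apply: le_trans (jensen_sqr (fun m => \sum_t p m s t * F t + (\sum_a u a) * (k == m)%:R) dw).
  rewrite le_eqVlt; apply/orP; left; apply/eqP; congr (_ ^+ 2).
  under [RHS]eq_bigr do rewrite mulrDr.
  rewrite big_split /=; congr (_ + _).
    under [RHS]eq_bigr do rewrite mulr_sumr.
    rewrite exchange_big /=; apply: eq_bigr => t _; rewrite mulr_suml.
    by apply: eq_bigr => m _; rewrite mulrA.
  rewrite (bigD1 k)//= eqxx [X in _ + X]big1 ?addr0 => [|m mk].
    by rewrite mulr1 /w divfK.
  by rewrite eq_sym (negbTE mk) !mulr0.
have -> : C = \sum_m w m * C by rewrite -mulr_suml dw.2 mul1r.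
apply: ler_sum => m _.
by apply: ler_wpM2l; [exact: (distr_ge0 dw)|exact: (pC m).2].
Qed.

Lemma exposable_shift d b mu u nu1 nu2 : exposable d b mu -> distr mu ->
  (forall k, 0 <= u k) -> distr nu1 -> distr nu2 ->
  dominated nu1 mu -> dominated nu2 mu ->
  exists2 p, transports nu1 nu2 p & shift_cost b u nu1 p <=
    2 * (\sum_k u k) ^+ 2
    + 2 * shift_const * (al * rel_ent nu1 mu + be * rel_ent nu2 mu).
Proof.
have C0 : 0 <= shift_const by rewrite /shift_const addr_ge0// mulr_ge0// sqr_ge0.
elim: d b mu u nu1 nu2 => [|d IH] b mu u nu1 nu2 ex dmu u0 d1 d2 ac1 ac2.
  have X0 : 0 <= al * rel_ent nu1 mu + be * rel_ent nu2 mu.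
    by rewrite addr_ge0// mulr_ge0 ?rel_ent_ge0// ltW.
  case: ex => s0 mu0; have tp := point_transports mu0 d1 d2 ac1 ac2.
  exists (fun s t => (s == t)%:R) => //; rewrite shift_cost_point//.
  have := sum_sqr_le u0; have := sqr_ge0 (\sum_k u k).
  have : 0 <= shift_const * (al * rel_ent nu1 mu + be * rel_ent nu2 mu).
    exact: mulr_ge0.
  lra.
set X := al * _ + _.
have X0 : 0 <= X by rewrite addr_ge0// mulr_ge0 ?rel_ent_ge0// ltW.
have CX : 0 <= shift_const * X by exact: mulr_ge0.
pose trivial m := exists i, forall s, mu s != 0 -> orient b s m = i.
have step m U : 0 <= U -> ~ trivial m -> exists2 p, transports nu1 nu2 p
    & shift_cost b (fun k => U * (k == m)%:R) nu1 p <= 2 * U ^+ 2 + 2 * shift_const * X.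
  move=> U0 ntr; case: (ex m) => // -[w [mus [r [fib rii rij mex]]]].
  apply: (shift_step U0 fib) => // i u' n1 n2 wi u'0 dn1 dn2 an1 an2.
  apply: IH => //; first exact: mex.
  by case: fib => _ + _ _ _; apply.
(* The unperturbed bound: either every coordinate is determined and [mu] is a point mass, or some
   undetermined coordinate can be revealed with [U = 0]. *)
have claim0 : exists2 p, transports nu1 nu2 p
    & shift_cost b (fun=> 0) nu1 p <= 2 * shift_const * X.
  have [alltriv|] := pselect (forall m, trivial m).
    have [s0 s0mu] := distr_neq0 dmu.
    have mu0 s : s != s0 -> mu s = 0.
      apply: contra_neq_eq => smu; apply: (can_inj (@orient_orient n b)).
      apply/permP => m; have [i im] := alltriv m.
      by rewrite !im.
    exists (fun s t => (s == t)%:R); first exact: point_transports mu0 d1 d2 ac1 ac2.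
    by rewrite shift_cost_point// big1 => [|k _]; [lra|rewrite expr0n].
  move=> /existsNP[m /(step m 0 (lexx _))[p tp]].
  rewrite expr0n mulr0 add0r => h; exists p => //; apply: le_trans h.
  rewrite le_eqVlt; apply/orP; left; apply/eqP; apply: eq_bigr => s _.
  by congr (_ * _); apply: eq_bigr => k _; rewrite mul0r.
(* If coordinate [m] is determined under [mu], no kernel moves it, so a perturbation concentrated
   there only adds [U ^+ 2] to the unperturbed cost. *)
have branch m U : 0 <= U -> exists2 p, transports nu1 nu2 p
    & shift_cost b (fun k => U * (k == m)%:R) nu1 p <= 2 * U ^+ 2 + 2 * shift_const * X.
  move=> U0; have [[i mi]|] := pselect (trivial m); last exact: step.
  have [p tp pC] := claim0; exists p => //.
  apply: (@le_trans _ _ (U ^+ 2 + shift_cost b (fun=> 0) nu1 p)); last first.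
    by have := sqr_ge0 U; lra.
  have -> : U ^+ 2 = \sum_s nu1 s * U ^+ 2 by rewrite -mulr_suml d1.2 mul1r.
  rewrite -big_split /=; apply: ler_sum => s _.
  rewrite -mulrDr; have [->|s0] := eqVneq (nu1 s) 0; first by rewrite !mul0r.
  apply: ler_wpM2l; first exact: (distr_ge0 d1).
  have vm : \sum_t p s t * (orient b s m != orient b t m)%:R = 0 :> R.
    apply: big1 => t _; have [->|p0] := eqVneq (p s t) 0; first by rewrite mul0r.
    have t0 := transports_neq0 tp d1 s0 p0.
    rewrite !mi ?eqxx ?mulr0//; first by apply: contra_neq t0 => /ac2.
    by apply: contra_neq s0 => /ac1.
  rewrite (bigD1 m)//= [leRHS]addrC [X in _ <= X + _](bigD1 m)//= vm eqxx.
  rewrite mulr1 !add0r expr0n add0r addrC lerD2r.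
  by apply: ler_sum => k /negbTE ->; rewrite mulr0.
have [u00|Un0] := eqVneq (\sum_k u k) 0.
  have [p tp pC] := claim0; exists p => //.
  rewrite u00 expr0n mulr0 add0r; apply: le_trans pC.
  rewrite le_eqVlt; apply/orP; left; apply/eqP; apply: eq_bigr => s _.
  congr (_ * _); apply: eq_bigr => k _; congr ((_ + _) ^+ 2).
  by apply/eqP; rewrite eq_le u0 -u00 (bigD1 k)//= lerDl sumr_ge0.
have /choice[p pP] m : exists p, transports nu1 nu2 p /\
    shift_cost b (fun k => (\sum_a u a) * (k == m)%:R) nu1 p <=
      2 * (\sum_k u k) ^+ 2 + 2 * shift_const * X.
  have [|p tp pC] := branch m (\sum_k u k); first exact: sumr_ge0.
  by exists p.
exact: (shift_cost_mix d1 u0 Un0 pP).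
Qed.

End Perturbed.

(** * Measures generated by a local base *)

Section Degree.
Variable n : nat.
Implicit Types (s t x : 'S_n).

Lemma pdeg1 : pdeg (1%g : 'S_n) = 0%N.
Proof.
by rewrite /pdeg; apply/eqP; rewrite cards_eq0; apply/eqP/finset.setP => i; rewrite !inE perm1 eqxx.
Qed.

Lemma pdegV s : pdeg s^-1%g = pdeg s.
Proof.
rewrite /pdeg; congr #|pred_of_set _|; apply/finset.setP => i; rewrite !inE.
by rewrite -(inj_eq (@perm_inj _ s)) permKV eq_sym.
Qed.

Lemma pdegJ s x : pdeg (x^-1 * s * x)%g = pdeg s.
Proof.
rewrite /pdeg -(card_imset (mem (psupp s)) (@perm_inj _ x)).
congr #|pred_of_set _|; apply/finset.setP => i.
have [k ->] : exists k, i = x k by exists (x^-1%g i); rewrite permKV.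
by rewrite (mem_imset _ _ (@perm_inj _ x)) !inE !permM permK (inj_eq perm_inj).
Qed.

Lemma permV_img s i j : s i = j -> s^-1%g j = i.
Proof. by move=> <-; rewrite permK. Qed.

Lemma psuppM s t : psupp (s * t)%g \subset psupp s :|: psupp t.
Proof.
apply/fintype.subsetP => i; rewrite !inE permM.
by have [->|//] := eqVneq (s i) i.
Qed.

End Degree.

Section PartialLaw.
Variables (R : realType) (n l : nat) (G : {group 'S_n}) (t : 'I_n -> 'I_n -> 'S_n).
Variable nuh : 'I_n -> 'I_n -> R.
Hypothesis tP : localbase l G t.
Hypothesis nuhP : forall j : 'I_n, (0 < j)%N -> prob (localorb G j) (nuh j).

Definition fixge (k : nat) (s : 'S_n) : Prop := forall i : 'I_n, (k <= i)%N -> s i = i.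

Lemma fixgeM k r s : fixge k r -> fixge k s -> fixge k (r * s)%g.
Proof. by move=> fr fs i ki; rewrite permM fr ?fs. Qed.

Lemma fixgeV k s : fixge k s -> fixge k s^-1%g.
Proof. by move=> fs i ki; apply: (@perm_inj _ s); rewrite permKV fs. Qed.

Lemma fixgeS k s : fixge k s -> fixge k.+1 s.
Proof. by move=> fs i /ltnW; exact: fs. Qed.

Lemma fixge_pred (j : 'I_n) (s : 'S_n) : fixge j.+1 s -> s j = j -> fixge j s.
Proof.
move=> fs sj i; rewrite leq_eqVlt => /predU1P[ji|]; last exact: fs.
by have -> : i = j by exact: val_inj.
Qed.

Lemma fixge_le (j : 'I_n) s : fixge j.+1 s -> (s j <= j)%N.
Proof.
move=> fs; rewrite leqNgt; apply/negP => h.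
by have := perm_inj (fs _ h) => e; rewrite e ltnn in h.
Qed.

Lemma fixge0 (j : 'I_n) s : ~~ (0 < j)%N -> fixge j.+1 s -> fixge j s.
Proof.
move=> j0 fs; apply: fixge_pred => //; apply/val_inj/eqP.
have := fixge_le fs; move: j0; rewrite -leqNgt leqn0 => /eqP /= ->.
by rewrite leqn0.
Qed.

(** The count leaves out [j], which two base elements of the same level can share; this saves one
    point in the degree [2 * l - 1] of their quotient. *)
Lemma localbaseP (j i : 'I_n) : (0 < j)%N -> i \in localorb G j ->
  [/\ t i j \in G, fixge j.+1 (t i j), t i j i = j
    & (#|psupp (t i j) :\ j| <= l.-1)%N].
Proof.
move=> j0 iO; have [tjj tij] := tP j0; have [->|ij] := eqVneq i j.
  rewrite tjj group1 perm1; split=> // [k _|]; first by rewrite perm1.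
  by rewrite (leq_trans (subset_leq_card (finset.subsetDl _ _)))// -/(pdeg _) pdeg1.
have [/fixaboveP[tG fixt] ti tl] := tij i iO ij; split=> //.
have jt : j \in psupp (t i j).
  by rewrite inE; apply: contra_neq ij => tj; apply: (@perm_inj _ (t i j)); rewrite ti tj.
by move: tl; rewrite /pdeg (cardsD1 j) jt; case: (l).
Qed.

Lemma localbase_pdeg (j i : 'I_n) : (0 < j)%N -> i \in localorb G j -> (pdeg (t i j) <= l)%N.
Proof.
move=> j0 iO; have [tjj tij] := tP j0; have [->|ij] := eqVneq i j.
  by rewrite tjj pdeg1.
by have [] := tij i iO ij.
Qed.

Lemma localbase_pdeg2 (j i k : 'I_n) : (0 < l)%N -> (0 < j)%N -> i \in localorb G j ->
  k \in localorb G j -> (pdeg (t i j * (t k j)^-1)%g <= 2 * l - 1)%N.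
Proof.
move=> l0 j0 iO kO; have [_ _ _ ci] := localbaseP j0 iO.
have [_ _ _ ck] := localbaseP j0 kO.
have supV : psupp (t k j)^-1%g = psupp (t k j).
  apply/finset.setP => a; rewrite !inE.
  by rewrite -(inj_eq (@perm_inj _ (t k j))) permKV eq_sym.
have sub : psupp (t i j * (t k j)^-1)%g \subset
    j |: ((psupp (t i j) :\ j) :|: (psupp (t k j) :\ j)).
  apply: fintype.subset_trans (psuppM _ _) _; rewrite supV.
  by apply/fintype.subsetP => a; rewrite !inE; case: (a == j).
rewrite /pdeg; apply: leq_trans (subset_leq_card sub) _.
rewrite cardsU1; have := leq_b1 (j \notin psupp (t i j) :\ j :|: psupp (t k j) :\ j).
have := finset.leq_card_setU (psupp (t i j) :\ j) (psupp (t k j) :\ j).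
move: l0 ci ck; case: (l) => // l' _ /= ci ck h1 h2.
have -> : (2 * l'.+1 - 1 = 1 + (l' + l'))%N by rewrite mul2n -addnn addnS subn1.
by rewrite leq_add// (leq_trans h1)// leq_add.
Qed.

Lemma nuh_orb (j i : 'I_n) : (0 < j)%N -> nuh j i != 0 -> i \in localorb G j.
Proof.
move=> j0; apply: contra_neqT => iO; have [_ out _] := nuhP j0; exact: out.
Qed.

Lemma nuh_distr (j : 'I_n) : (0 < j)%N -> distr (nuh j).
Proof.
move=> j0; have [ge0 out s1] := nuhP j0; split=> //.
by rewrite -s1 [RHS]big_mkcond; apply: eq_bigr => i _; case: ifPn => // /out.
Qed.

(* The law of [t_{x_2,2} ... t_{x_k,k}] for independent [x_j] of law [nuh j]. *)
Fixpoint partial_law (k : nat) (s : 'S_n) : R :=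
  match k with
  | 0 => (s == 1%g)%:R
  | k'.+1 => if (insub k' : option 'I_n) is Some j
             then if (0 < j)%N then \sum_i nuh j i * partial_law k' ((t i j)^-1 * s)%g
                  else partial_law k' s
             else partial_law k' s
  end.

Lemma partial_lawS (j : 'I_n) s : partial_law j.+1 s =
  if (0 < j)%N then \sum_i nuh j i * partial_law j ((t i j)^-1 * s)%g
  else partial_law j s.
Proof. by rewrite [LHS]/= valK. Qed.

Lemma partial_law_ind (P : nat -> Prop) : P 0%N -> (forall j : 'I_n, P j -> P j.+1) ->
  forall k, (k <= n)%N -> P k.
Proof. by move=> P0 PS; elim=> // k IH kn; apply: (PS (Ordinal kn)); exact: IH (ltnW kn). Qed.

Lemma partial_law_distr k : (k <= n)%N -> distr (partial_law k).
Proof.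
move: k; apply: partial_law_ind => [|j [IH0 IH1]].
  split=> [s|]; first exact: ler0n.
  by rewrite (bigD1 1%g)//= eqxx big1 ?addr0// => s /negbTE ->.
have [j0|j0] := boolP (0 < j)%N; last first.
  split=> [s|]; first by rewrite partial_lawS (negbTE j0).
  by under eq_bigr do rewrite partial_lawS (negbTE j0).
have [nu0 nu1] := nuh_distr j0.
split=> [s|].
  by rewrite partial_lawS j0; apply: sumr_ge0 => i _; rewrite mulr_ge0.
under eq_bigr do rewrite partial_lawS j0.
rewrite exchange_big /= -nu1; apply: eq_bigr => i _; rewrite -mulr_sumr.
by rewrite (sum_bij (partial_law j) (mulgI _)) IH1 mulr1.
Qed.

Lemma partial_lawS_neq0 (j : 'I_n) s : (0 < j)%N -> partial_law j.+1 s != 0 ->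
  exists i, nuh j i != 0 /\ partial_law j ((t i j)^-1 * s)%g != 0.
Proof.
move=> j0; rewrite partial_lawS j0 => h.
suff /existsP[i] : [exists i, nuh j i * partial_law j ((t i j)^-1 * s)%g != 0].
  by rewrite mulf_eq0 negb_or => /andP[]; exists i.
apply: contraNT h => /existsPn h; apply/eqP/big1 => i _; apply/eqP.
by have := h i; rewrite negbK.
Qed.

Lemma partial_law_supp k s : (k <= n)%N -> partial_law k s != 0 -> s \in G /\ fixge k s.
Proof.
move=> kn; move: k kn s; apply: partial_law_ind => [s|j IH s].
  rewrite /=; case: (s =P 1%g) => [->|_]; last by rewrite eqxx.
  by split=> // i _; rewrite perm1.
have [j0|j0] := boolP (0 < j)%N; last first.
  by rewrite partial_lawS (negbTE j0) => /IH[sG /fixgeS].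
move=> /(partial_lawS_neq0 j0)[i [nui /IH[sG fs]]].
have [tG ft _ _] := localbaseP j0 (nuh_orb j0 nui).
have -> : s = (t i j * ((t i j)^-1 * s))%g by rewrite mulKVg.
by split; [rewrite groupM|apply: fixgeM => //; exact: fixgeS].
Qed.

(** As [t i j * s] sends [i] to [j], it determines the index of its newest factor, and a single term
    of the mixture survives. *)
Lemma partial_law_cell (j i : 'I_n) (s : 'S_n) : (0 < j)%N -> i \in localorb G j -> s j = j ->
  partial_law j.+1 (t i j * s)%g = nuh j i * partial_law j s.
Proof.
move=> j0 iO sj; rewrite partial_lawS j0 (bigD1 i)//= mulKg big1 ?addr0// => k ki.
have [->|nuk] := eqVneq (nuh j k) 0; first by rewrite mul0r.
have [->|pk] := eqVneq (partial_law j ((t k j)^-1 * (t i j * s))%g) 0; first by rewrite mulr0.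
have [_ fs] := partial_law_supp (ltnW (ltn_ord j)) pk.
have [_ _ ti _] := localbaseP j0 iO.
have [_ _ tk _] := localbaseP j0 (nuh_orb j0 nuk).
move: (fs j (leqnn _)); rewrite !permM (permV_img tk) -[in RHS]sj => /perm_inj.
by rewrite -[in RHS]ti => /perm_inj e; rewrite e eqxx in ki.
Qed.

Lemma partial_law_trivial (j : 'I_n) : localorb G j = [set j] ->
  partial_law j.+1 =1 partial_law j.
Proof.
move=> Oj s; rewrite partial_lawS; case: ifP => // j0.
have [_ out s1] := nuhP j0; have [tjj _] := tP j0.
rewrite Oj big_set1 in s1.
rewrite (bigD1 j)//= s1 mul1r tjj invg1 mul1g big1 ?addr0// => i ij.
by rewrite out ?mul0r// Oj inE.
Qed.

Section Fibres.
Variables (b : bool) (x y : 'S_n) (m j : 'I_n).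
Hypotheses (j0 : (0 < j)%N) (ym : y m = j).

(** With [y m = j], the event [orient b s m = a] says that [x * orient (~~ b) s * y] sends [x^-1 a]
    to [j]; thus [x^-1 a] is the index of the newest base element. *)
Definition law_weight (a : 'I_n) : R := nuh j (x^-1%g a).

Definition law_piece (a : 'I_n) (s : 'S_n) : R :=
  partial_law j ((t (x^-1%g a) j)^-1 * (x * orient (~~ b) s * y))%g.

(** Conjugation by [x] passes from indices to revealed values and preserves the degree. *)
Definition law_shift (a a' : 'I_n) : 'S_n :=
  (x^-1 * (t (x^-1%g a) j * (t (x^-1%g a') j)^-1) * x)%g.

Lemma law_shift_id a : law_shift a a = 1%g.
Proof. by rewrite /law_shift mulgV mulg1 mulVg. Qed.

Lemma law_shift_img a a' : law_weight a != 0 -> law_weight a' != 0 ->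
  law_shift a a' a = a'.
Proof.
move=> /(nuh_orb j0) aO /(nuh_orb j0) aO'.
have [_ _ ta _] := localbaseP j0 aO; have [_ _ ta' _] := localbaseP j0 aO'.
rewrite /law_shift !permM ta.
by rewrite (permV_img ta') permKV.
Qed.

Lemma law_fibred : fibred (fun s => orient b s m) law_weight law_piece
  (fun a a' => lact b (law_shift a a'))
  (fun s => partial_law j.+1 (x * orient (~~ b) s * y)%g).
Proof.
have jn := ltnW (ltn_ord j).
have [nu0 nu1] := nuh_distr j0.
split.
- split=> [a|]; first exact: nu0.
  by rewrite -[RHS]nu1 /law_weight (sum_bij (nuh j) (@perm_inj _ x^-1)).
- move=> a wa; have [p0 p1] := partial_law_distr jn.
  split=> [s|]; first exact: p0.
  rewrite -[RHS]p1 /law_piece.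
  apply: (sum_bij (partial_law j)) => s s' /mulgI/mulIg/mulgI.
  exact: (bij_inj (orient_bij n (~~ b))).
- move=> a s wa /(partial_law_supp jn)[_ fs].
  have [_ _ ta _] := localbaseP j0 (nuh_orb j0 wa).
  have := fs j (leqnn _); rewrite !permM (permV_img ta) permKV -ym => /perm_inj; rewrite orientN => <-.
  by rewrite permKV.
- move=> s; rewrite partial_lawS j0.
  rewrite [RHS](reindex_inj (@perm_inj _ x)); apply: eq_bigr => i _.
  by rewrite /law_weight /law_piece permK.
- move=> a a' wa wa'; split; first exact: lact_inj.
  move=> s; rewrite /law_piece orientN orient_lact invMg -orientN /law_shift.
  congr (partial_law _ _); rewrite !invMg !invgK !mulgA.
  by rewrite mulgK mulVg mul1g.
Qed.

End Fibres.

Section Chain.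
Variables (d : 'S_n -> 'S_n -> R) (c : R).
Hypothesis d_step : forall (j i k : 'I_n) (x s z : 'S_n), (0 < j)%N ->
  i \in localorb G j -> k \in localorb G j -> x \in G -> s \in G -> z \in G ->
  d s ((x^-1 * (t i j * (t k j)^-1) * x)^-1 * z)%g <= d s z + c.

Definition level (k : nat) : nat :=
  #|[set j : 'I_n | [&& (j < k)%N, (0 < j)%N & localorb G j != [set j]]]|.

Lemma levelS (j : 'I_n) :
  level j.+1 = (level j + ((0 < j)%N && (localorb G j != [set j])))%N.
Proof.
rewrite /level (cardsD1 j) addnC inE ltnSn /=; congr (_ + _)%N.
congr #|pred_of_set _|; apply/finset.setP => i; rewrite !inE ltnS leq_eqVlt.
by have [->|ij] := eqVneq i j; [rewrite ltnn|rewrite -val_eqE /= in ij; rewrite (negbTE ij)].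
Qed.

(** The translation by [x] keeps the induction going: a piece of [partial_law j.+1] is a translate
    of [partial_law j]. *)
Lemma law_chain k (x : 'S_n) : (k <= n)%N -> x \in G ->
  chain 'I_n d c (level k) (fun s => partial_law k (x * s)%g).
Proof.
move=> kn; move: k kn x; apply: partial_law_ind => [x _|j IH x xG].
  have -> : level 0 = 0%N.
    by apply/eqP; rewrite cards_eq0; apply/eqP/finset.setP => i; rewrite !inE.
  apply: (@ChainPoint _ _ _ _ _ _ x^-1%g) => s sx /=; case: eqP => // xs.
  by rewrite -[s](mulKg x) xs mulg1 eqxx in sx.
rewrite levelS; have [Oj|Oj] := eqVneq (localorb G j) [set j].
  rewrite andbF addn0 (_ : (fun s => _) = fun s => partial_law j (x * s)%g).
    exact: IH.
  by apply/funext => s; exact: partial_law_trivial.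
have j0 : (0 < j)%N by rewrite lt0n; apply: contra_neq Oj => /localorb0.
rewrite j0 addn1.
have -> : (fun s => partial_law j.+1 (x * s)%g)
    = (fun s => partial_law j.+1 (x * orient (~~ false) s * 1)%g).
  by apply/funext => s; rewrite mulg1.
apply: (ChainFibred (law_fibred false x j0 (perm1 j))) => [a a' s z wa wa'|a wa].
- have jn := ltnW (ltn_ord j).
  have aO := nuh_orb j0 wa; have aO' := nuh_orb j0 wa'.
  have [tG _ _ _] := localbaseP j0 aO.
  have inG s' : law_piece false x 1 j a s' != 0 -> s' \in G.
    move=> /(partial_law_supp jn)[+ _]; rewrite mulg1 mulgA groupMl //.
    by rewrite groupM ?groupV.
  move=> /inG sG /inG zG /=.
  have [<-|_] := eqVneq a a'; first by rewrite law_shift_id invg1 mul1g mulr0 addr0.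
  by rewrite mulr1; exact: d_step.
- rewrite (_ : law_piece _ _ _ _ _ = fun s => partial_law j (((t (x^-1%g a) j)^-1 * x) * s)%g).
    have [tG _ _ _] := localbaseP j0 (nuh_orb j0 wa).
    by apply: IH; rewrite groupM ?groupV.
  by apply/funext => s; rewrite /law_piece mulg1 mulgA.
Qed.

End Chain.

(** * Revealing an arbitrary position under a conjugation-invariant law *)

Section Exposable.
Hypothesis l0 : (0 < l)%N.

(* Conjugation invariance itself is not inherited from [partial_law j.+1] by
   [partial_law j] when [nuh j j = 0]; these two weak forms always are. *)
Definition translation_compensated (k : nat) : Prop := forall u : 'S_n, fixge k u ->
  exists2 phi : 'S_n, fixge k phi &
    forall s, partial_law k (phi * s * u)%g = partial_law k s.

Definition inverse_compensated (k : nat) : Prop :=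
  exists a c : 'S_n, [/\ fixge k a, fixge k c &
    forall s, partial_law k s^-1%g = partial_law k (a * s * c)%g].

Lemma partial_law_out (j : 'I_n) (s : 'S_n) : s j != j -> partial_law j s = 0.
Proof.
apply: contraNeq => /(partial_law_supp (ltnW (ltn_ord j)))[_ fs].
by apply/eqP; exact: fs.
Qed.

(** Since [u] fixes [j], the symmetry [(phi, u)] of [partial_law j.+1] carries the cell of a charged
    index [i] onto that of another one [i']. Conjugating by the two base elements gives the
    compensation [psi] at the lower level. *)
Lemma translation_compensated_pred (j : 'I_n) : translation_compensated j.+1 -> translation_compensated j.
Proof.
move=> inv u fu; have jn := ltnW (ltn_ord j).
have uj : u j = j by exact: fu.
have [phi fphi phiP] := inv u (fixgeS fu).
have [j0|j0] := boolP (0 < j)%N; last first.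
  exists phi; first exact: fixge0.
  by move=> s; have := phiP s; rewrite !partial_lawS (negbTE j0).
have [i nui] := distr_neq0 (nuh_distr j0).
have [s0 ps0] := distr_neq0 (partial_law_distr jn).
have iO := nuh_orb j0 nui; have [tG ft ti _] := localbaseP j0 iO.
have [_ fs0] := partial_law_supp jn ps0; have s0j := fs0 j (leqnn _).
have : partial_law j.+1 (phi * (t i j * s0) * u)%g != 0.
  by rewrite phiP partial_law_cell// mulf_neq0.
move=> /(partial_lawS_neq0 j0)[i' [nui' /(partial_law_supp jn)[_ fs]]].
have iO' := nuh_orb j0 nui'; have [_ ft' ti' _] := localbaseP j0 iO'.
pose psi := ((t i' j)^-1 * phi * t i j)%g.
have psij : psi j = j.
  apply: (@perm_inj _ s0); apply: (@perm_inj _ u); rewrite s0j uj -[RHS](fs j (leqnn _)).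
  by rewrite /psi !permM.
have fpsi : fixge j psi.
  apply: fixge_pred psij; apply: fixgeM ft; apply: fixgeM fphi; exact: fixgeV.
have cell (s : 'S_n) : nuh j i * partial_law j s = nuh j i' * partial_law j (psi * s * u)%g.
  have [sj|sj] := eqVneq (s j) j; last first.
    by rewrite !partial_law_out ?mulr0// permM permM psij -[X in _ != X]uj (inj_eq perm_inj).
  rewrite -!partial_law_cell//; last by rewrite permM permM psij sj.
  by rewrite -phiP /psi !mulgA mulgV mul1g.
exists psi => // s.
(* Equality of the weights follows by summing [cell] over all permutations, as [partial_law j] has
   mass 1. *)
have nuE : nuh j i = nuh j i'.
  have h : \sum_s nuh j i * partial_law j s
      = \sum_s nuh j i' * partial_law j (psi * s * u)%g.
    by apply: eq_bigr => s1 _; exact: cell.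
  move: h; rewrite -!mulr_sumr.
  rewrite (sum_bij (partial_law j) (f := fun s => (psi * s * u)%g)).
    by rewrite (partial_law_distr jn).2 !mulr1.
  by move=> s1 s2 /mulIg/mulgI.
by apply: (mulfI nui); rewrite [RHS]cell -nuE.
Qed.

Lemma inverse_compensated_pred (j : 'I_n) : translation_compensated j.+1 ->
  inverse_compensated j.+1 -> inverse_compensated j.
Proof.
move=> inv [a [c [fa fc acP]]]; have jn := ltnW (ltn_ord j).
have [j0|j0] := boolP (0 < j)%N; last first.
  exists a, c; split=> [||s]; [exact: fixge0|exact: fixge0|].
  by have := acP s; rewrite !partial_lawS (negbTE j0).
have [i nui] := distr_neq0 (nuh_distr j0).
have [s0 ps0] := distr_neq0 (partial_law_distr jn).
have iO := nuh_orb j0 nui; have [tG ft ti _] := localbaseP j0 iO.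
have [_ fs0] := partial_law_supp jn ps0.
(* The right factor [c'] need not fix [j]; the transposition [u] corrects this, and [phi] pays for
   it on the left. The rest parallels the case of translations. *)
pose c' := ((t i j)^-1 * c)%g; pose u := tperm (c' j) j.
have fc' : fixge j.+1 c' by apply: fixgeM fc; exact: fixgeV.
have fu : fixge j.+1 u.
  move=> k jk; rewrite tpermD// -val_eqE /= neq_ltn ?jk//.
  by rewrite (leq_ltn_trans (fixge_le fc') jk).
have [phi fphi phiP] := inv u fu.
pose c2 := (c' * u)%g.
have c2j : c2 j = j by rewrite permM tpermL.
have fc2 : fixge j c2 by apply: fixge_pred c2j; exact: fixgeM.
have key (s : 'S_n) : s j = j -> nuh j i * partial_law j s^-1%g = partial_law j.+1 (phi * a * s * c2)%g.
  move=> sj; rewrite -partial_law_cell//; last by rewrite (permV_img sj).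
  have -> : (t i j * s^-1)%g = (s * (t i j)^-1)^-1%g by rewrite invMg invgK.
  by rewrite acP -phiP /c2 /c' !mulgA.
have s0j : s0^-1%g j = j by rewrite (permV_img (fs0 j (leqnn _))).
have : partial_law j.+1 (phi * a * s0^-1 * c2)%g != 0.
  by rewrite -key// invgK mulf_neq0.
move=> /(partial_lawS_neq0 j0)[i' [nui' /(partial_law_supp jn)[_ fs]]].
have iO' := nuh_orb j0 nui'; have [_ ft' ti' _] := localbaseP j0 iO'.
pose a2 := ((t i' j)^-1 * phi * a)%g.
have a2j : a2 j = j.
  apply: (@perm_inj _ s0^-1%g); apply: (@perm_inj _ c2); rewrite s0j c2j.
  by rewrite -[RHS](fs j (leqnn _)) /a2 !permM.
have fa2 : fixge j a2.
  apply: fixge_pred a2j; apply: fixgeM fa; apply: fixgeM fphi; exact: fixgeV.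
have cell (s : 'S_n) : nuh j i * partial_law j s^-1%g = nuh j i' * partial_law j (a2 * s * c2)%g.
  have [sj|sj] := eqVneq (s j) j; last first.
    have sVj : s^-1%g j != j by apply: contra_neq sj => /permV_img; rewrite invgK.
    by rewrite !partial_law_out ?mulr0// (permM (a2 * s)%g) (permM a2) a2j -[X in _ != X]c2j (inj_eq perm_inj).
  rewrite key// -partial_law_cell//; last by rewrite (permM (a2 * s)%g) (permM a2) a2j sj.
  by rewrite /a2 !mulgA mulgV mul1g.
exists a2, c2; split=> // s.
have nuE : nuh j i = nuh j i'.
  have h : \sum_s nuh j i * partial_law j s^-1%g
      = \sum_s nuh j i' * partial_law j (a2 * s * c2)%g.
    by apply: eq_bigr => s1 _; exact: cell.
  move: h; rewrite -!mulr_sumr.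
  rewrite (sum_bij (partial_law j) (f := fun s => s^-1%g)); last exact: invg_inj.
  rewrite (sum_bij (partial_law j) (f := fun s => (a2 * s * c2)%g)).
    by rewrite (partial_law_distr jn).2 !mulr1.
  by move=> s1 s2 /mulIg/mulgI.
by apply: (mulfI nui); rewrite cell -nuE.
Qed.

Lemma orient_conj b (x y s : 'S_n) m :
  orient b s m = x ((x * orient (~~ b) s * y)^-1%g (y m)).
Proof. by rewrite !invMg !permM permK -orientN negbK permKV. Qed.

(** The base reveals only its top index [j]. Translation compensation replaces any position not
    determined yet by this one, and inverse compensation switches the orientation in which the
    pieces are read. *)
Lemma law_exposable k b x y : (k <= n)%N -> translation_compensated k ->
  inverse_compensated k ->
  exposable (2 * l - 1) k b (fun s => partial_law k (x * orient (~~ b) s * y)%g).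
Proof.
move=> kn; move: k kn b x y; apply: partial_law_ind => [b x y _ _|j IH b x y inv inv'].
  exists (orient (~~ b) (x^-1 * y^-1)%g) => s; apply: contra_neq_eq => h.
  apply: (can_inj (@orient_orient n (~~ b))); rewrite orient_orient.
  move: h => /=; case: (_ =P 1%g) => [h _|_]; last by rewrite eqxx.
  by apply: (mulgI x); apply: (mulIg y); rewrite h mulKVg mulVg.
have jn := ltnW (ltn_ord j).
have IHj := IH _ _ _ (translation_compensated_pred inv) (inverse_compensated_pred inv inv').
move=> m; have [j0|j0] := boolP (0 < j)%N; last first.
  left; exists (x (y m)) => s.
  rewrite partial_lawS (negbTE j0) => /(partial_law_supp jn)[_ fs].
  rewrite (orient_conj b x y); congr (x _); apply: fixgeV fs _ _.
  by move: j0; rewrite -leqNgt leqn0 => /eqP ->.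
(* Points above [j] are fixed by the support of [partial_law j.+1], so this position is
   determined. *)
have [jy|yj] := ltnP j (y m).
  left; exists (x (y m)) => s /(partial_law_supp (ltn_ord j))[_ fs].
  by rewrite (orient_conj b x y); congr (x _); apply: fixgeV fs _ _.
(* The transposition brings [y m] to [j], as [law_fibred] requires; [phi] compensates it. *)
right; pose u := tperm (y m) j.
have fu : fixge j.+1 u.
  move=> k jk; rewrite tpermD// -val_eqE /= neq_ltn ?jk//.
  by rewrite (leq_ltn_trans yj jk).
have [phi fphi phiP] := inv u fu.
have yum : (y * u)%g m = j by rewrite permM tpermL.
have -> : (fun s => partial_law j.+1 (x * orient (~~ b) s * y)%g)
    = (fun s => partial_law j.+1 ((phi * x) * orient (~~ b) s * (y * u))%g).
  by apply/funext => s; rewrite -phiP !mulgA.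
do 3 eexists; split; first exact: (law_fibred b (phi * x) j0 yum).
- by move=> i; exact: law_shift_id.
- move=> i i' wi wi' _; split; first exact: law_shift_img.
  by rewrite pdegJ; apply: localbase_pdeg2 => //; exact: nuh_orb.
(* Inverting the argument through [acP] puts the piece in the form of the induction hypothesis with
   [b] negated. *)
- move=> i wi; have [a [c [_ _ acP]]] := inverse_compensated_pred inv inv'.
  set x' := (phi * x)%g; set y' := (y * u)%g.
  have -> : law_piece b x' y' j i = fun s => partial_law j
      ((a * y'^-1) * orient (~~ ~~ b) s * (x'^-1 * t (x'^-1%g i) j * c))%g.
    apply/funext => s; rewrite /law_piece.
    rewrite -[in LHS](invgK ((t (x'^-1 i) j)^-1 * (x' * orient (~~ b) s * y'))%g) acP.
    by rewrite orientN negbK !invMg !invgK !mulgA.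
  exact: IHj.
Qed.

End Exposable.

End PartialLaw.

Section PermcompLaw.
Variable n : nat.

Let permcompA : associative (@permcomp n).
Proof. by move=> s r q; rewrite /permcomp mulgA. Qed.

Let permcomp1s : left_id 1%g (@permcomp n).
Proof. by move=> s; rewrite /permcomp mulg1. Qed.

Let permcomps1 : right_id 1%g (@permcomp n).
Proof. by move=> s; rewrite /permcomp mul1g. Qed.

(** The monoid structure gives access to [big_mkcond] and [big_ord_recr] for products of
    [permcomp]. *)
HB.instance Definition _ :=
  Monoid.isLaw.Build 'S_n 1%g (@permcomp n) permcompA permcomp1s permcomps1.

End PermcompLaw.

Section LawOfProduct.
Variables (R : realType) (n l : nat) (G : {group 'S_n}) (t : 'I_n -> 'I_n -> 'S_n).
Variable nuh : 'I_n -> 'I_n -> R.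
Hypothesis tP : localbase l G t.
Hypothesis nuhP : forall j : 'I_n, (0 < j)%N -> prob (localorb G j) (nuh j).

(** The dummy coordinate of index 0 gets the point mass at its only orbit point, so that the sum
    over [family] extends to all functions. *)
Let coordw (j i : 'I_n) : R := if (0 < j)%N then nuh j i else (i == j)%:R.

Let coordw_distr j : distr (coordw j).
Proof.
rewrite /coordw; case: (boolP (0 < j)%N) => [j0|_]; first exact: (nuh_distr nuhP j0).
split=> [i|]; first exact: ler0n.
by rewrite (bigD1 j)//= eqxx big1 ?addr0// => i /negbTE ->.
Qed.

Let weight (x : {ffun 'I_n -> 'I_n}) : R := \prod_j coordw j (x j).

Let set_coord (x : {ffun 'I_n -> 'I_n}) (j i : 'I_n) : {ffun 'I_n -> 'I_n} :=
  [ffun k => if k == j then i else x k].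

Let weight_sum : \sum_x weight x = 1.
Proof.
rewrite /weight -(bigA_distr_bigA coordw) big1// => j _.
exact: (coordw_distr j).2.
Qed.

Let weight_swap (x : {ffun 'I_n -> 'I_n}) j i : coordw j (x j) * weight (set_coord x j i) = coordw j i * weight x.
Proof.
rewrite /weight (bigD1 j)//= [in RHS](bigD1 j)//= ffunE eqxx.
rewrite mulrCA; congr (_ * (_ * _)); apply: eq_bigr => k kj.
by rewrite ffunE (negbTE kj).
Qed.

(* Exchanging the coordinate [x j] with an independent copy [i] of it. *)
Let weight_split (j : 'I_n) (A : {ffun 'I_n -> 'I_n} -> 'I_n -> R) :
  (forall x i k, A (set_coord x j i) k = A x k) ->
  \sum_x weight x * A x (x j) = \sum_i coordw j i * \sum_x weight x * A x i.
Proof.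
move=> Aj.
transitivity (\sum_x \sum_i coordw j i * (weight x * A x (x j))).
  by apply: eq_bigr => x _; rewrite -mulr_suml (coordw_distr j).2 mul1r.
rewrite pair_big /=.
pose h (xi : {ffun 'I_n -> 'I_n} * 'I_n) := (set_coord xi.1 j xi.2, xi.1 j).
have hK : involutive h.
  case=> x i; rewrite /h /=; congr (_, _); last by rewrite ffunE eqxx.
  by apply/ffunP => k; rewrite !ffunE; case: eqP => [->|].
rewrite (reindex_inj (inv_inj hK)) /=.
under [RHS]eq_bigr do rewrite mulr_sumr.
rewrite [RHS]exchange_big pair_big /=; apply: eq_bigr => -[x i] _ /=.
by rewrite Aj ffunE eqxx !mulrA weight_swap.
Qed.

Let factor (x : {ffun 'I_n -> 'I_n}) (k : nat) : 'S_n :=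
  if (insub k : option 'I_n) is Some j then if (0 < j)%N then t (x j) j else 1%g else 1%g.

Let uprod (k : nat) x : 'S_n := \big[@permcomp n/1%g]_(i < k) factor x i.

(** As [permcomp] reverses the product, the newest factor appears on the left, as in
    [partial_law]. *)
Let uprodS (j : 'I_n) x :
  uprod j.+1 x = ((if (0 < j)%N then t (x j) j else 1) * uprod j x)%g.
Proof.
by rewrite /uprod big_ord_recr /= /permcomp /factor valK.
Qed.

Let uprod_indep (j : 'I_n) k (x : {ffun 'I_n -> 'I_n}) i : (k <= j)%N -> uprod k (set_coord x j i) = uprod k x.
Proof.
move=> kj; apply: eq_bigr => a _; rewrite /factor; case: insubP => // b _ ba.
rewrite ffunE; case: eqP => // bj; have := ltn_ord a.
by rewrite -ba bj ltnNge kj.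
Qed.

Let uprod_law k s : (k <= n)%N ->
  \sum_x weight x * (uprod k x == s)%:R = partial_law t nuh k s.
Proof.
move=> kn; move: k kn s; apply: (@partial_law_ind n) => [s|j IH s].
  rewrite /uprod; under eq_bigr do rewrite big_ord0.
  by rewrite -mulr_suml weight_sum mul1r /= eq_sym.
rewrite partial_lawS; have [j0|j0] := boolP (0 < j)%N; last first.
  by rewrite -IH; apply: eq_bigr => x _; rewrite uprodS (negbTE j0) mul1g.
under [RHS]eq_bigr do rewrite -IH.
transitivity (\sum_x weight x * (uprod j x == ((t (x j) j)^-1 * s)%g)%:R).
  apply: eq_bigr => x _; rewrite uprodS j0; congr (_ * (nat_of_bool _)%:R).
  by rewrite -[in RHS](inj_eq (mulgI (t (x j) j))) mulKVg.
rewrite (weight_split (A := fun x i => (uprod j x == ((t i j)^-1 * s)%g)%:R)).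
  by apply: eq_bigr => i _; rewrite /coordw j0.
by move=> x i k; rewrite uprod_indep.
Qed.

Lemma Umap_law s :
  \sum_(x in family (localorb G) | Umap t x == s)
    \prod_(j < n | (0 < j)%N) nuh j (x j) = partial_law t nuh n s.
Proof.
rewrite -uprod_law// big_mkcond /=; apply: eq_bigr => x _.
have -> : Umap t x = uprod n x.
  rewrite /Umap /uprod big_mkcond; apply: eq_bigr => j _.
  by rewrite /factor valK.
have [xO|xO] := boolP (x \in family (localorb G)); last first.
  rewrite andFb; suff -> : weight x = 0 by rewrite mul0r.
  have [j xj] : exists j, x j \notin localorb G j.
    by apply/existsP; apply: contraNT xO => /existsPn xO; apply/familyP => j; have := xO j; rewrite negbK.
  rewrite /weight (bigD1 j)//= /coordw; case: ifPn => j0.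
    by have [_ out _] := nuhP j0; rewrite out ?mul0r.
  move: xj; rewrite localorb0 ?inE; last by move: j0; rewrite -leqNgt leqn0 => /eqP.
  by move=> /negbTE ->; rewrite mul0r.
rewrite andTb; case: eqP => _; last by rewrite mulr0.
rewrite mulr1 /weight big_mkcond /=; apply: eq_bigr => j _.
rewrite /coordw; case: ifPn => // j0.
have := familyP xO j; rewrite localorb0 ?inE; last by move: j0; rewrite -leqNgt leqn0 => /eqP.
by move=> ->.
Qed.

End LawOfProduct.

(** * Uniform laws of local groups *)

Section LocalCells.
Variables (R : realType) (n l : nat) (G : {group 'S_n}).
Hypothesis Gl : local_group l G.
Implicit Types (b : bool) (S : {set 'I_n}) (g s : 'S_n).

(** For [g] in [G], a coset of a pointwise stabiliser, on the side determined by [b]. *)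
Definition cell b S g : {set 'S_n} :=
  [set s in G | [forall k in S, orient b s k == orient b g k]].

Lemma cellP b S g s : reflect (s \in G /\ forall k, k \in S -> orient b s k = orient b g k)
  (s \in cell b S g).
Proof.
rewrite inE; apply: (iffP andP) => -[sG h]; split=> //.
  by move=> k kS; apply/eqP; move/forallP: h => /(_ k); rewrite kS.
by apply/forall_inP => k kS; apply/eqP; exact: h.
Qed.

Lemma cell0 b : cell b finset.set0 1%g = G.
Proof.
by apply/finset.setP => s; apply/cellP/idP => [[]|sG] //; split=> // k; rewrite inE.
Qed.

Lemma cell_fibre b S g m h : h \in cell b S g ->
  [set s in cell b S g | orient b s m == orient b h m] = cell b (m |: S) h.
Proof.
move=> /cellP[hG hS]; apply/finset.setP => s; rewrite 2!inE.
apply/andP/cellP => [[/andP[sG /forall_inP sS] /eqP sm]|[sG sS]]; split=> //.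
- by move=> k /setU1P[->//|kS]; rewrite hS//; apply/eqP/sS.
- rewrite sG; apply/forall_inP => k kS; rewrite sS ?hS ?eqxx//.
  by rewrite !inE kS orbT.
- by rewrite sS// !inE eqxx.
Qed.

(** Prescribing images of positions amounts to prescribing preimages of the resulting values; this
    permits the orientation to alternate. *)
Lemma cellN b S h : cell b S h = cell (~~ b) (orient b h @: S) h.
Proof.
apply/finset.setP => s; apply/cellP/cellP => -[sG sS]; split=> //.
  move=> _ /imsetP[k kS ->]; rewrite !orientN permK -(sS k kS).
  by rewrite permK.
move=> k kS; have := sS (orient b h k) (imset_f _ kS).
by rewrite !orientN permK => /permV_img; rewrite invgK.
Qed.

Lemma unif_distr (A : {set 'S_n}) : A != finset.set0 -> distr (unif R A).
Proof.
move=> A0; split=> [s|]; first by rewrite /unif; case: ifP.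
rewrite /unif -big_mkcond /= sumr_const -[LHS]mulr_natl divff//.
by rewrite pnatr_eq0 cards_eq0.
Qed.

Lemma orient_in b s : (orient b s \in G) = (s \in G).
Proof. by case: b => //=; rewrite groupV. Qed.

Section Reveal.
Variables (b : bool) (S : {set 'I_n}) (g : 'S_n) (m : 'I_n).
Hypothesis gG : g \in G.

Definition fibre (i : 'I_n) : {set 'S_n} := [set s in cell b S g | orient b s m == i].

(** The quotient [h] of an element of each fibre sends [i] to [j] and fixes the prescribed images of
    [S]. Locality yields [r] of degree at most [l] supported in the support of [h], so [r] fixes
    these images too. *)
Lemma fibre_shift i j : exists r : 'S_n, (i = j -> r = 1%g) /\
  (i != j -> fibre i != finset.set0 -> fibre j != finset.set0 ->
   [/\ r \in G, r i = j, (pdeg r <= l)%N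
     & forall k, k \in S -> r (orient b g k) = orient b g k]).
Proof.
have [->|ij] := eqVneq i j; first by exists 1%g.
have [_|/finset.set0Pn[si]] := eqVneq (fibre i) finset.set0.
  by exists 1%g.
rewrite inE => /andP[/cellP[siG siS] /eqP sim].
have [_|/finset.set0Pn[sj]] := eqVneq (fibre j) finset.set0.
  by exists 1%g.
rewrite inE => /andP[/cellP[sjG sjS] /eqP sjm].
pose h := ((orient b si)^-1 * orient b sj)%g.
have hG : h \in G by rewrite groupM ?groupV ?orient_in.
have hi : h i = j by rewrite permM -sim permK.
have [r [rG rh rl ri]] := Gl hG hi.
exists r; split=> [e|_ _ _]; first by rewrite e eqxx in ij.
split=> // k kS; apply/eqP; apply: contraT => rk.
have : orient b g k \in psupp h by apply: (fintype.subsetP rh); rewrite inE.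
by rewrite inE permM -{1}(siS k kS) permK (sjS k kS) eqxx.
Qed.

Lemma fibre_lact r i j s : r \in G -> r i = j ->
  (forall k, k \in S -> r (orient b g k) = orient b g k) ->
  (lact b r s \in fibre j) = (s \in fibre i).
Proof.
move=> rG ri rS; rewrite !inE orient_lact permM -ri (inj_eq perm_inj).
congr (_ && _ && _).
  by rewrite -(orient_in b) orient_lact groupMr// orient_in.
apply: eq_forallb => k; case kS : (k \in S) => //=.
by rewrite permM -{1}(rS k kS) (inj_eq perm_inj).
Qed.

Lemma fibre_weight_neq0 i :
  #|fibre i|%:R / #|cell b S g|%:R != 0 :> R -> fibre i != finset.set0.
Proof. by apply: contra_neq => ->; rewrite cards0 mul0r. Qed.

Lemma cell_fibred : exists r : 'I_n -> 'I_n -> 'S_n,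
  [/\ fibred (fun s => orient b s m) (fun i => #|fibre i|%:R / #|cell b S g|%:R)
        (fun i => unif R (fibre i)) (fun i j => lact b (r i j)) (unif R (cell b S g)),
      forall i, r i i = 1%g
    & forall i j, fibre i != finset.set0 -> fibre j != finset.set0 -> i != j ->
        [/\ r i j \in G, r i j i = j & (pdeg (r i j) <= l)%N]].
Proof.
have /choice[r rP] (ij : 'I_n * 'I_n) := fibre_shift ij.1 ij.2.
have cell_neq0 : cell b S g != finset.set0.
  by apply/finset.set0Pn; exists g; apply/cellP.
have c0 : #|cell b S g|%:R != 0 :> R by rewrite pnatr_eq0 cards_eq0.
exists (fun i j => r (i, j)); split=> [|i|i j i0 j0 ij].
- split.
  + split=> [i|]; first by rewrite divr_ge0.
    rewrite -mulr_suml -natr_sum; apply: (mulIf c0); rewrite divfK// mul1r.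
    congr _%:R; rewrite -[RHS]sum1_card (partition_big (fun s => orient b s m) xpredT)//=.
    by apply: eq_bigr => i _; rewrite -sum1_card; apply: eq_bigl => s; rewrite inE.
  + by move=> i /fibre_weight_neq0; exact: unif_distr.
  + move=> i s _; rewrite /unif; case: ifP => [|_]; last by rewrite eqxx.
    by rewrite inE => /andP[_ /eqP].
  + move=> s; rewrite (bigD1 (orient b s m))//= big1 ?addr0.
      rewrite /unif [s \in fibre _]inE eqxx andbT.
      case: ifP => [sc|_]; last by rewrite mulr0.
      have f0 : #|fibre (orient b s m)|%:R != 0 :> R.
        rewrite pnatr_eq0 cards_eq0; apply/finset.set0Pn; exists s.
        by rewrite inE sc eqxx.
      by field; exact/andP.
    by move=> i si; rewrite /unif inE eq_sym (negbTE si) andbF mulr0.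
  + move=> i j /fibre_weight_neq0 i0 /fibre_weight_neq0 j0; split; first exact: lact_inj.
    move=> s; have [r1 r2] /= := rP (i, j).
    have [ij|ij] := eqVneq i j.
      by rewrite r1// ij; case: (b); rewrite /= ?mulg1 ?invg1 ?mul1g.
    have [rG ri _ rS] := r2 ij i0 j0.
    have e := fibre_lact _ rG ri rS; rewrite /unif e.
    suff -> : #|fibre i| = #|fibre j| by [].
    (* Multiplication by [r] is a bijection between the two fibres, which are therefore of the same
       size and carry matching uniform laws. *)
    rewrite -(card_preimset (fibre j) (@lact_inj n b (r (i, j)))).
    by apply: eq_card => s'; rewrite [RHS]inE e.
- by have [r1 _] := rP (i, i); rewrite r1.
- by have [_ /(_ ij i0 j0)[]] := rP (i, j).
Qed.

End Reveal.

Lemma fibre_cell b S g m i : fibre b S g m i != finset.set0 ->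
  exists2 h, h \in G & fibre b S g m i = cell b (m |: S) h.
Proof.
move=> /finset.set0Pn[h]; rewrite inE => /andP[hc /eqP <-].
by exists h; [case/cellP: hc|exact: cell_fibre].
Qed.

(** [d] bounds the number of free positions; each new revelation uses up one, and re-reading the
    cell by [cellN] keeps their number. *)
Lemma cell_exposable d b S g : g \in G -> (#|~: S| <= d)%N ->
  exposable l d b (unif R (cell b S g)).
Proof.
elim: d b S g => [|d IH] b S g gG Sd.
  exists g => s sg; rewrite /unif; case: ifP => // /cellP[_ sS].
  case/eqP: sg; apply: (can_inj (@orient_orient n b)); apply/permP => k.
  apply: sS; move: Sd; rewrite leqn0 cards_eq0 => /eqP/finset.setP/(_ k).
  by rewrite !inE => /negbFE.
move=> m; have [mS|mS] := boolP (m \in S).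
  left; exists (orient b g m) => s; rewrite /unif.
  by case: ifP => [/cellP[_ ->]//|_]; rewrite eqxx.
right; have [r [fib rii rij]] := cell_fibred b S m gG.
do 3 eexists; split; [exact: fib|exact: rii| |].
  by move=> i j /fibre_weight_neq0 i0 /fibre_weight_neq0 j0 ij; have [] := rij i j i0 j0 ij.
move=> i /fibre_weight_neq0/fibre_cell[h hG ->]; rewrite cellN; apply: IH => //.
rewrite cardsCs finset.setCK card_imset; last exact: perm_inj.
move: Sd; rewrite [#|~: S|]cardsCs finset.setCK cardsU1 mS add1n.
by rewrite subnS; case: (_ - _)%N.
Qed.

Section Chain.
Variables (d : 'S_n -> 'S_n -> R) (c : R).
Hypothesis d_step : forall (r s z : 'S_n), r \in G -> (pdeg r <= l)%N -> s \in G -> z \in G ->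
  d s (r^-1 * z)%g <= d s z + c.

Lemma cell_chain k g : (k <= n)%N -> g \in G ->
  chain 'I_n d c (level G k) (unif R (cell false [set j : 'I_n | (k <= j)%N] g)).
Proof.
move=> kn; move: k kn g; apply: partial_law_ind => [g gG|j IH g gG].
  have -> : level G 0 = 0%N.
    by apply/eqP; rewrite cards_eq0; apply/eqP/finset.setP => i; rewrite !inE.
  apply: (@ChainPoint _ _ _ _ _ _ g) => s sg; rewrite /unif; case: ifP => // /cellP[_ sS].
  case/eqP: sg; apply: (can_inj (@orient_orient n false)); apply/permP => k.
  by apply: sS; rewrite inE.
have SE : [set i : 'I_n | (j <= i)%N] = j |: [set i : 'I_n | (j < i)%N].
  apply/finset.setP => i; rewrite !inE leq_eqVlt; congr (_ || _).
  by rewrite -val_eqE eq_sym.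
rewrite levelS; have [Oj|Oj] := eqVneq (localorb G j) [set j].
  rewrite andbF addn0 (_ : cell _ _ _ = cell false [set i : 'I_n | (j <= i)%N] g).
    exact: IH.
  apply/finset.setP => s; apply/cellP/cellP => -[sG sS]; split=> // i; last first.
    by move=> ji; apply: sS; move: ji; rewrite !inE => /ltnW.
  rewrite inE leq_eqVlt => /predU1P[/val_inj <-|ji]; last by apply: sS; rewrite inE.
  (* Two elements of the cell have a quotient fixing all points above [j]; a trivial orbit forces it
     to fix [j], so revealing [j] brings nothing new. *)
  have : (s^-1 * g)%g j \in localorb G j.
    apply/localorbP; exists (s^-1 * g)%g => //; apply/fixaboveP; split.
      by rewrite groupM ?groupV.
    by move=> k jk; rewrite permM (sS k) ?inE//= permKV.
  by rewrite Oj inE permM => /eqP /permV_img.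
have j0 : (0 < j)%N by rewrite lt0n; apply: contra_neq Oj => /localorb0.
rewrite j0 addn1; have [r [fib rii rij]] := cell_fibred false [set i : 'I_n | (j < i)%N] j gG.
apply: (ChainFibred fib) => [i i' s z /fibre_weight_neq0 i0 /fibre_weight_neq0 i0'|i].
  have inG s' : unif R (fibre false [set k : 'I_n | (j < k)%N] g j i) s' != 0 -> s' \in G.
    rewrite /unif; case: ifP => [|_]; last by rewrite eqxx.
    by rewrite inE => /andP[/cellP[]].
  move=> /inG sG /inG zG /=.
  have [<-|ii'] := eqVneq i i'; first by rewrite rii invg1 mul1g mulr0 addr0.
  by have [rG _ rl] := rij _ _ i0 i0' ii'; rewrite mulr1; exact: d_step.
by move=> /fibre_weight_neq0/fibre_cell[h hG ->]; rewrite -SE; exact: IH.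
Qed.

End Chain.

End LocalCells.

(** * Distances, transport costs and extended entropies *)

Section Distances.
Variables (n l : nat) (G : {group 'S_n}).
Implicit Types (r s t u v z : 'S_n).

Lemma dH_mull r s z : (dH s (r * z)%g <= dH s z + pdeg r)%N.
Proof.
rewrite !dHE /pdeg -sum1_card [X in (_ <= _ + X)%N]big_mkcond -big_split /=.
apply: leq_sum => i _; rewrite inE permM.
by have [->|_] := eqVneq (r i) i; rewrite ?addn0// addn1 (leq_trans (leq_b1 _)).
Qed.

Lemma dHss s : dH s s = 0%N.
Proof. by rewrite /dH /permcomp mulVg pdeg1. Qed.

Lemma pdeg_le r : (pdeg r <= n)%N.
Proof. by rewrite -[n in leqRHS]card_ord max_card. Qed.

Lemma connects_rcons s t u k : connects l G s t k -> u \in G -> (pdeg u <= l)%N ->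
  connects l G s (u * t)%g k.+1.
Proof.
move=> /existsP[w /andP[wG /eqP wt]] uG ul.
apply/existsP; exists [tuple of rcons w u]; rewrite /= all_rcons uG ul wG /=.
by rewrite -cats1 foldl_cat /= wt /permcomp.
Qed.

Lemma dT_min s t k : connects l G s t k -> (dT l G s t <= k)%N.
Proof.
by rewrite /dT; case: pselect => [h|//]; case: ex_minnP => m _; apply.
Qed.

Lemma dTss s : dT l G s s = 0%N.
Proof.
apply/eqP; rewrite -leqn0; apply: dT_min; apply/existsP; exists [tuple].
by rewrite /= eqxx.
Qed.

Variable fam : 'I_n -> 'I_n -> 'S_n.
Hypothesis famP : localbase l G fam.

Lemma dT_connects s t : s \in G -> t \in G -> connects l G s t (dT l G s t).
Proof.
move=> sG tG; have h := localbase_connects famP sG tG.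
by rewrite /dT; case: pselect => [h'|//]; case: ex_minnP.
Qed.

Lemma dT_mull r s z : r \in G -> (pdeg r <= l)%N -> s \in G -> z \in G ->
  (dT l G s (r * z)%g <= dT l G s z + 1)%N.
Proof.
move=> rG rl sG zG; apply: dT_min; rewrite addn1.
by apply: connects_rcons => //; exact: dT_connects.
Qed.

End Distances.

Section CostsOfKernels.
Variables (R : realType) (T : finType) (A : {set T}).
Implicit Types (nu : T -> R).

Lemma prob_distr nu : prob A nu -> distr nu.
Proof.
move=> [ge0 out s1]; split=> //.
by rewrite -s1 [RHS]big_mkcond; apply: eq_bigr => x _; case: ifPn => // /out.
Qed.

Lemma sum_support (F : T -> R) : (forall x, x \notin A -> F x = 0) ->
  \sum_(x in A) F x = \sum_x F x.
Proof.
by move=> F0; rewrite big_mkcond; apply: eq_bigr => x _; case: ifPn => // /F0.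
Qed.

Variables nu1 nu2 : T -> R.
Hypotheses (p1 : prob A nu1) (p2 : prob A nu2).
Variable p : T -> T -> R.
Hypothesis tp : transports nu1 nu2 p.

(** A disintegration asks for a probability on [A] at every point; [nu2] serves as default where
    [nu1] vanishes. *)
Definition full_kernel x : T -> R := if nu1 x == 0 then nu2 else p x.

Definition joint (xy : T * T) : R := nu1 xy.1 * p xy.1 xy.2.

Lemma kernel_out x y : nu1 x != 0 -> y \notin A -> p x y = 0.
Proof.
move=> x0; apply: contraNeq => pxy.
have := transports_neq0 tp (prob_distr p1) x0 pxy.
by apply: contraNT; case: p2 => _ out _ /out ->.
Qed.

Lemma joint_coupling : coupling A nu1 nu2 joint.
Proof.
have d1 := prob_distr p1; have [ge1 out1 s1] := p1; have [ge2 out2 s2] := p2.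
have outr x y : y \notin A -> joint (x, y) = 0.
  move=> yA; rewrite /joint /=; have [->|x0] := eqVneq (nu1 x) 0; first by rewrite mul0r.
  by rewrite kernel_out ?mulr0.
have outl x y : x \notin A -> joint (x, y) = 0.
  by move=> xA; rewrite /joint /= out1 ?mul0r.
have row x : \sum_(y in A) joint (x, y) = nu1 x.
  rewrite sum_support; last by move=> y; exact: outr.
  rewrite /joint /= -mulr_sumr; have [->|x0] := eqVneq (nu1 x) 0; first by rewrite mul0r.
  by rewrite (tp.1 _ x0).2 mulr1.
split=> [|x _|y _]; last 2 first.
- exact: row.
- by rewrite sum_support; [rewrite -tp.2|move=> x; exact: outl].
split=> [[x y]|[x y]|].
- rewrite /joint /=; have [->|x0] := eqVneq (nu1 x) 0; first by rewrite mul0r.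
  by rewrite mulr_ge0//; exact: (distr_ge0 (tp.1 _ x0)).
- by rewrite finset.in_setX negb_and => /orP[/outl|/outr] ->.
- transitivity (\sum_(x in A) \sum_(y in A) joint (x, y)).
    rewrite pair_big_dep /=; apply: eq_big => [[x y]|[x y] _] //.
    by rewrite finset.in_setX.
  by under eq_bigr do rewrite row.
Qed.

Lemma full_kernel_disintegration : disintegration A nu1 joint full_kernel.
Proof.
split=> [x _|x y _ _]; rewrite /full_kernel.
  have [//|x0] := eqVneq (nu1 x) 0; have [ge s1] := tp.1 _ x0.
  split=> // [y|]; first exact: kernel_out.
  by rewrite sum_support// => y; exact: kernel_out.
by rewrite /joint /=; case: eqP => // ->; rewrite !mul0r.
Qed.

Lemma full_kernel_sum (F : T -> R) x : nu1 x != 0 ->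
  \sum_(y in A) F y * full_kernel x y = \sum_y p x y * F y.
Proof.
move=> x0; rewrite sum_support /full_kernel (negbTE x0).
  by apply: eq_bigr => y _; rewrite mulrC.
by move=> y yA; rewrite kernel_out ?mulr0.
Qed.

Lemma W1_le (d : T -> T -> nat) :
  W1 A d nu1 nu2 <= \sum_x nu1 x * \sum_y p x y * (d x y)%:R.
Proof.
apply: ge_inf.
  exists 0 => _ [pi [[pi0 _ _] _ _] ->].
  by do 2 (apply: sumr_ge0 => ? _); rewrite mulr_ge0.
exists joint; first exact: joint_coupling.
rewrite [RHS]sum_support => [|x xA]; last first.
  by rewrite big1// => y _; rewrite /joint /=; case: p1 => _ out _; rewrite out ?mul0r ?mulr0.
apply: eq_bigr => x _; rewrite /joint /=.
have [->|x0] := eqVneq (nu1 x) 0; first by rewrite mul0r big1// => y _; rewrite mul0r mulr0.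
rewrite sum_support; last by move=> y yA; rewrite kernel_out ?mulr0.
by rewrite mulr_sumr; apply: eq_bigr => y _; ring.
Qed.

Lemma W1_ge0 (d : T -> T -> nat) : 0 <= W1 A d nu1 nu2.
Proof.
apply: lb_le_inf; first by exists (\sum_(x in A) \sum_(y in A) (d x y)%:R * joint (x, y)), joint => //; exact: joint_coupling.
move=> _ [pi [[pi0 _ _] _ _] ->].
by do 2 (apply: sumr_ge0 => ? _); rewrite mulr_ge0.
Qed.

Lemma T2tilde_le (d : T -> T -> nat) :
  T2tilde A d nu2 nu1 <= \sum_x nu1 x * (\sum_y p x y * (d x y)%:R) ^+ 2.
Proof.
apply: ge_inf.
  exists 0 => _ [pi [k [_ _ ->]]]; apply: sumr_ge0 => x _.
  by rewrite mulr_ge0 ?sqr_ge0//; case: p1.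
exists joint, full_kernel; split; [exact: joint_coupling|exact: full_kernel_disintegration|].
rewrite [RHS]sum_support => [|x xA]; last by case: p1 => _ out _; rewrite out ?mulr0.
apply: eq_bigr => x _; have [->|x0] := eqVneq (nu1 x) 0; first by rewrite mul0r mulr0.
by rewrite full_kernel_sum// mulrC.
Qed.

End CostsOfKernels.

Section T2hatOfKernels.
Variables (R : realType) (n : nat) (G : {group 'S_n}) (nu1 nu2 : 'S_n -> R).
Hypotheses (p1 : prob G nu1) (p2 : prob G nu2).

Lemma T2hat_le p : transports nu1 nu2 p ->
  T2hat G nu2 nu1 <= shift_cost true (fun=> 0) nu1 p.
Proof.
move=> tp; apply: ge_inf.
  exists 0 => _ [pi [k [_ _ ->]]]; apply: sumr_ge0 => x _.
  rewrite mulr_ge0//; last by case: p1.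
  by apply: sumr_ge0 => i _; exact: sqr_ge0.
exists (joint nu1 p), (full_kernel nu1 nu2 p); split.
- exact: joint_coupling.
- exact: full_kernel_disintegration.
rewrite [RHS]sum_support => [|x xA]; last by case: p1 => _ out _; rewrite out ?mulr0.
apply: eq_bigr => s _; have [->|s0] := eqVneq (nu1 s) 0; first by rewrite mul0r mulr0.
rewrite mulrC; congr (_ * _); apply: eq_bigr => i _.
by rewrite addr0 (full_kernel_sum p1 p2 tp (fun t : 'S_n => (s i != t i)%:R)).
Qed.

End T2hatOfKernels.

(** * Optimising the conjugate weights; infinite entropies *)

Section EntropyTerm.
Variable R : realType.

(** Conjugate weights are parametrised as [1 + t] and [1 + t^-1]; the minimum is at
    [t = sqrt y / sqrt x]. If [x] or [y] is 0 it is only approached, hence the passage to the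
    limit. *)
Lemma le_sqr_sqrtD (x y Y : R) : 0 <= x -> 0 <= y ->
  (forall t, 0 < t -> Y <= (1 + t) * x + (1 + t^-1) * y) ->
  Y <= (Num.sqrt x + Num.sqrt y) ^+ 2.
Proof.
move=> x0 y0 H; rewrite sqrrD !sqr_sqrtr//.
have limit z (C : R) : 0 <= z -> (forall t, 0 < t -> C <= (1 + t) * z) -> C <= z.
  move=> z0 h; apply/ler_addgt0Pr => e e0.
  have := h (e / (z + 1)) _; rewrite divr_gt0// ?ltr_wpDl// => /(_ isT).
  move/le_trans; apply; rewrite mulrDl mul1r lerD2l.
  rewrite -mulrA ler_piMr ?(ltW e0)// mulrC ler_pdivrMr ?ltr_wpDl// mul1r lerDl//.
move: x0; rewrite le_eqVlt => /predU1P[x0|x0].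
  rewrite -x0 sqrtr0 mul0r mul0rn !add0r; apply: limit => // t t0.
  have := H t^-1; rewrite invr_gt0 => /(_ t0).
  by rewrite invrK -x0 mulr0 add0r.
move: y0; rewrite le_eqVlt => /predU1P[y0|y0].
  rewrite -y0 sqrtr0 mulr0 mul0rn !addr0; apply: limit; first exact: ltW.
  by move=> t /H; rewrite -y0 mulr0 addr0.
have sx : 0 < Num.sqrt x by rewrite sqrtr_gt0.
have sy : 0 < Num.sqrt y by rewrite sqrtr_gt0.
have := H (Num.sqrt y / Num.sqrt x) (divr_gt0 sy sx).
rewrite -[x in (1 + _) * x](sqr_sqrtr (ltW x0)) -[y in (1 + _^-1) * y](sqr_sqrtr (ltW y0)).
rewrite -[x in _ -> _ <= x + _ + _](sqr_sqrtr (ltW x0)) -[y in _ -> _ <= _ + y](sqr_sqrtr (ltW y0)).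
move/le_trans; apply; rewrite le_eqVlt; apply/orP; left; apply/eqP.
by field; rewrite !gt_eqF.
Qed.

Lemma sqr_le_of_hyperbola (W a b : R) : 0 <= W -> 0 <= a -> 0 <= b ->
  (forall t, 0 < t -> W <= t * a + b / t) -> W ^+ 2 <= 4 * a * b.
Proof.
move=> W0 a0 b0 H; have [->|Wn0] := eqVneq W 0.
  by rewrite expr0n !mulr_ge0.
have Wgt0 : 0 < W by rewrite lt_neqAle eq_sym Wn0.
move: a0; rewrite le_eqVlt => /predU1P[a0|a0].
  (* For [a = 0] this large [t] contradicts [W > 0]; otherwise [t = W / (2 * a)] gives the bound. *)
  have t0 : 0 < 2 * b / W + 1 by rewrite ltr_wpDl// divr_ge0// mulr_ge0.
  have := H _ t0; rewrite -a0 mulr0 add0r ler_pdivlMr//.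
  have -> : W * (2 * b / W + 1) = 2 * b + W by field.
  lra.
have t0 : 0 < W / (2 * a) by rewrite divr_gt0// mulr_gt0.
have := H _ t0; have -> : W / (2 * a) * a = W / 2 by field; rewrite gt_eqF.
have -> : b / (W / (2 * a)) = 2 * a * b / W by field; rewrite Wn0 gt_eqF.
rewrite -lerBlDl ler_pdivlMr//; nra.
Qed.

Variables (n : nat) (mu nu1 nu2 : 'S_n -> R).

Lemma entropy_dominated nu : dominated nu mu -> entropy nu mu = (rel_ent nu mu)%:E.
Proof.
move=> h; rewrite /entropy ifT//; apply/forallP => s; apply/implyP => /eqP m0.
by rewrite h.
Qed.

Lemma entropy_not_dominated nu : ~ dominated nu mu -> entropy nu mu = +oo%E.
Proof.
move=> h; rewrite /entropy ifF//; apply/negP => /forallP f; apply: h => s m0.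
by have := f s; rewrite m0 eqxx => /eqP.
Qed.

(** An infinite entropy makes the right side [+oo] only if [K > 0], because [0 * +oo] is 0; for
    [K = 0] domination must be supplied. *)
Lemma le_entropy_term (K Y : R) : 0 <= K ->
  distr mu -> distr nu1 -> distr nu2 ->
  (K = 0 -> dominated nu1 mu /\ dominated nu2 mu) ->
  (dominated nu1 mu -> dominated nu2 mu ->
    forall al be, 0 < al -> 0 < be -> al^-1 + be^-1 = 1 ->
      Y <= K * (al * rel_ent nu1 mu + be * rel_ent nu2 mu)) ->
  (Y%:E <= K%:E * entropy_term mu nu1 nu2)%E.
Proof.
move=> K0 dmu d1 d2 hK hY; rewrite /entropy_term.
have half : (2^-1 : R) != 0 by rewrite invr_neq0.
have [[ac1 ac2]|nac] := pselect (dominated nu1 mu /\ dominated nu2 mu).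
  rewrite !entropy_dominated// !poweR_EFin -EFinD -EFin_expe -EFinM lee_fin.
  have H1 := rel_ent_ge0 d1 dmu ac1; have H2 := rel_ent_ge0 d2 dmu ac2.
  rewrite !powR12_sqrt//.
  have -> : K * (Num.sqrt (rel_ent nu1 mu) + Num.sqrt (rel_ent nu2 mu)) ^+ 2 =
      (Num.sqrt (K * rel_ent nu1 mu) + Num.sqrt (K * rel_ent nu2 mu)) ^+ 2.
    by rewrite !sqrtrM// -mulrDr exprMn sqr_sqrtr.
  apply: le_sqr_sqrtD; rewrite ?mulr_ge0// => t t0.
  have := hY ac1 ac2 (1 + t) (1 + t^-1); rewrite !addr_gt0 ?invr_gt0//.
  have -> : (1 + t)^-1 + (1 + t^-1)^-1 = 1.
    by field; rewrite !gt_eqF// addr_gt0.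
  move=> /(_ isT isT erefl) /le_trans; apply.
  by rewrite le_eqVlt; apply/orP; left; apply/eqP; ring.
have Kgt0 : 0 < K.
  rewrite lt_neqAle eq_sym K0 andbT; apply/eqP => /hK h; exact: nac.
suff -> : ((entropy nu1 mu `^ 2^-1 + entropy nu2 mu `^ 2^-1) ^+ 2)%E = +oo%E.
  by rewrite gt0_muley ?lte_fin// leey.
have pow_ge0 nu : (0 <= entropy nu mu `^ 2^-1)%E by exact: poweR_ge0.
have noninfty nu : (entropy nu mu `^ 2^-1 != -oo)%E.
  by rewrite gt_eqF// (lt_le_trans _ (pow_ge0 nu)).
have sum_y : (entropy nu1 mu `^ 2^-1 + entropy nu2 mu `^ 2^-1)%E = +oo%E.
  have [ac1|nac1] := pselect (dominated nu1 mu); last first.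
    by rewrite (entropy_not_dominated nac1) poweRyr// addye.
  have nac2 : ~ dominated nu2 mu by move=> ac2; exact: nac.
  by rewrite (entropy_not_dominated nac2) poweRyr// addey.
by rewrite sum_y expe2 mulyy.
Qed.

End EntropyTerm.

(** * From chains and exposable laws to the transport-entropy inequalities *)

Section Assembly.
Variables (R : realType) (n l : nat) (G : {group 'S_n}) (mu : 'S_n -> R).
Hypothesis pmu : prob G mu.

Lemma Kn_level : Kn G = level G n.
Proof.
by rewrite /Kn /level; congr #|pred_of_set _|; apply/finset.setP => j; rewrite !inE ltn_ord.
Qed.

(** The largest point moved by an element of [G] has a nontrivial orbit. A trivial group supplies
    the domination required when [Kn G] is 0. *)
Lemma Kn0_trivial : Kn G = 0%N -> forall s, s \in G -> s = 1%g.
Proof.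
move=> /eqP; rewrite cards_eq0 => /eqP K0 s sG; apply/eqP; apply: contraT => s1.
have [j0 sj0] : exists j, s j != j.
  apply/existsP; apply: contraNT s1 => /existsPn h; apply/eqP/permP => j.
  by rewrite perm1; apply/eqP; have := h j; rewrite negbK.
case: (@arg_maxnP _ j0 (fun j => s j != j) (@nat_of_ord n) sj0) => j sj jmax.
have sfix : s \in fixabove G j.
  apply/fixaboveP; split=> // k jk; apply/eqP; apply: contraTT jk => /jmax.
  by rewrite -leqNgt.
have Oj : localorb G j != [set j].
  apply: contra_neq sj => Oj; have : s j \in localorb G j by apply/localorbP; exists s.
  by rewrite Oj inE => /eqP.
move/finset.setP/(_ j): K0; rewrite !inE Oj andbT.
by rewrite lt0n => /negbFE/eqP/localorb0 e; rewrite e eqxx in Oj.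
Qed.

Lemma Kn0_dominated nu : Kn G = 0%N -> prob G nu -> dominated nu mu.
Proof.
move=> K0 [_ out _] s ms; have [sG|/out //] := boolP (s \in G).
have [r mr] := distr_neq0 (prob_distr pmu); case/eqP: (mr).
have rG : r \in G by apply: contraNT mr => rG; case: pmu => _ o _; rewrite o.
by rewrite (Kn0_trivial K0 rG) -(Kn0_trivial K0 sG).
Qed.

Lemma chain_ineqs (d : 'S_n -> 'S_n -> nat) (c : R) : 0 < c ->
  (forall s, d s s = 0%N) -> chain 'I_n (fun s t => (d s t)%:R) c (Kn G) mu ->
  W1_ineq G mu d c /\ T2tilde_ineq G mu d c.
Proof.
move=> c0 dss ch; have dmu := prob_distr pmu.
have d0 s t : 0 <= (d s t)%:R :> R by [].
have dss' s : (d s s)%:R = 0 :> R by rewrite dss.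
split=> nu1 nu2 p1 p2; have d1 := prob_distr p1; have d2 := prob_distr p2.
- apply: le_entropy_term => // [/eqP|ac1 ac2 al be al0 be0 albe].
    by rewrite pnatr_eq0 => /eqP K0; split; exact: Kn0_dominated.
  set X := al * _ + _.
  have X0 : 0 <= X by rewrite addr_ge0// mulr_ge0 ?rel_ent_ge0// ltW.
  (* The value 1 is arbitrary: some coupling kernel is wanted, to see that the infimum [W1] is
     nonnegative. *)
  have [p tp _] := chain_W1 dss' al0 be0 albe ltr01 ch dmu d1 d2 ac1 ac2.
  have Wge0 := W1_ge0 p1 p2 tp d.
  have W_le lam : 0 < lam -> W1 G d nu1 nu2 <= lam * (Kn G)%:R / 2 + c ^+ 2 / (4 * lam) * X.
    move=> lam0; have [q tq qle] := chain_W1 dss' al0 be0 albe lam0 ch dmu d1 d2 ac1 ac2.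
    exact: le_trans (W1_le p1 p2 tq d) qle.
  set W := W1 _ _ _ _ in Wge0 W_le *.
  rewrite mulrAC ler_pdivrMr ?exprn_gt0//.
  have KR : 0 <= (Kn G)%:R / 2 :> R by rewrite divr_ge0.
  have BR : 0 <= c ^+ 2 * X / 4 by rewrite divr_ge0// mulr_ge0// sqr_ge0.
  suff : W ^+ 2 <= 4 * ((Kn G)%:R / 2) * (c ^+ 2 * X / 4) by lra.
  (* The bounds for all [lam] together give the square of [W1]. *)
  apply: sqr_le_of_hyperbola => // lam lam0; apply: le_trans (W_le _ lam0) _.
  by rewrite le_eqVlt; apply/orP; left; apply/eqP; field; rewrite gt_eqF.
- apply: le_entropy_term => // [/eqP|ac1 ac2 al be al0 be0 albe].
    by rewrite pnatr_eq0 => /eqP K0; split; exact: Kn0_dominated.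
  have [p tp ple] := chain_T2 d0 dss' al0 be0 albe ch dmu d1 d2 ac1 ac2.
  have h := le_trans (T2tilde_le p1 p2 tp d) ple.
  rewrite [leLHS]mulrC ler_pdivrMr ?mulr_gt0 ?exprn_gt0//; lra.
Qed.

Lemma exposable_ineq (L : nat) : exposable L n true mu ->
  T2hat_ineq G mu (shift_const R L).
Proof.
move=> ex nu1 nu2 p1 p2; have dmu := prob_distr pmu.
have d1 := prob_distr p1; have d2 := prob_distr p2.
rewrite -[X in (_ <= X)%E]mul1e; apply: le_entropy_term => // [/eqP|ac1 ac2 al be al0 be0 albe].
  by rewrite oner_eq0.
have [//|p tp ple] := exposable_shift al0 be0 albe (u := fun=> 0) ex dmu _ d1 d2 ac1 ac2.
have := le_trans (T2hat_le p1 p2 tp) ple.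
rewrite sumr_const mul0rn expr0n mulr0 add0r mul1r => h.
have c0 : 0 < shift_const R L.
  by rewrite /shift_const ltr_wpDl// mulr_ge0// sqr_ge0.
rewrite [leLHS]mulrC ler_pdivrMr ?mulr_gt0//; lra.
Qed.

End Assembly.

Theorem theorem1p3 (R : realType) (n l : nat) (G : {group 'S_n})
    (t : 'I_n -> 'I_n -> 'S_n) (mu : 'S_n -> R) :
  (2 <= n)%N -> (2 <= l <= n)%N ->
  localbase l G t -> prob G mu -> MT G t mu ->
  [/\ W1_ineq G mu (@dH n) (minn (2 * l - 1) n)%N%:R
      /\ T2tilde_ineq G mu (@dH n) (minn (2 * l - 1) n)%N%:R,
      W1_ineq G mu (dT l G) 2 /\ T2tilde_ineq G mu (dT l G) 2,
      local_group l G -> mu =1 unif R G ->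
        [/\ W1_ineq G mu (@dH n) l%:R, T2tilde_ineq G mu (@dH n) l%:R,
            W1_ineq G mu (dT l G) 1 & T2tilde_ineq G mu (dT l G) 1],
      local_group l G -> mu =1 unif R G ->
        T2hat_ineq G mu (2 * (l%:R - 1) ^+ 2 + 2)
    & normal G [set: 'S_n]%g ->
      (forall s, s \in G -> mu s = mu s^-1%g) ->
      (forall s u : 'S_n, s \in G -> mu s = mu (permcomp (permcomp u^-1%g s) u)) ->
        T2hat_ineq G mu (8 * (l%:R - 1) ^+ 2 + 2)].
Proof.
move=> n2 /andP[l2 ln] tP pmu [nuh [nuhP muE]].
have l0 : (0 < l)%N by exact: ltnW.
have muL : mu = partial_law t nuh n.
  by apply/funext => s; rewrite muE; exact: (Umap_law t nuhP).
have mu_out s : s \notin G -> mu s = 0 by case: pmu => _ + _; apply.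
have law_chain_mu d c (d_step : forall (j i k : 'I_n) (x s z : 'S_n), (0 < j)%N ->
    i \in localorb G j -> k \in localorb G j -> x \in G -> s \in G -> z \in G ->
    (d s ((x^-1 * (t i j * (t k j)^-1) * x)^-1 * z)%g <= d s z + c)%N) :
    chain 'I_n (fun s r => (d s r)%:R) c%:R (Kn G) mu.
  rewrite Kn_level (_ : mu = fun s => partial_law t nuh n (1 * s)%g).
    apply: (law_chain tP nuhP) => //.
    by move=> *; rewrite -natrD ler_nat; exact: d_step.
  by apply/funext => s; rewrite mul1g muL.
have full : [set j : 'I_n | (n <= j)%N] = finset.set0.
  by apply/finset.setP => j; rewrite !inE leqNgt ltn_ord.
have cell_chain_mu d c : local_group l G -> mu =1 unif R G ->
    (forall r s z : 'S_n, r \in G -> (pdeg r <= l)%N -> s \in G -> z \in G ->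
      (d s (r^-1 * z)%g <= d s z + c)%N) ->
    chain 'I_n (fun s r => (d s r)%:R) c%:R (Kn G) mu.
  move=> Gl muU d_step; rewrite Kn_level (_ : mu = unif R (cell G false [set j : 'I_n | (n <= j)%N] 1%g)).
    apply: (cell_chain Gl) => //.
    by move=> *; rewrite -natrD ler_nat; exact: d_step.
  by apply/funext => s; rewrite full cell0 muU.
have dT_mullV r s z : r \in G -> (pdeg r <= l)%N -> s \in G -> z \in G ->
    (dT l G s (r^-1 * z)%g <= dT l G s z + 1)%N.
  by move=> rG rl sG zG; apply: (dT_mull tP) => //; rewrite ?groupV ?pdegV.
split.
- apply: chain_ineqs => //; first by rewrite ltr0n leq_min subn_gt0 (leq_trans l2) ?leq_pmull// ltnW.
    exact: dHss.
  apply: law_chain_mu => j i k x s z j0 iO kO xG sG zG.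
  (* The matching has the degree of a quotient of two base elements, at most [2 * l - 1], and
     trivially at most [n]. *)
  apply: leq_trans (dH_mull _ _ _) _; rewrite leq_add2l pdegV leq_min pdeg_le andbT pdegJ.
  exact: (localbase_pdeg2 tP).
- apply: chain_ineqs => //; first exact: dTss.
  apply: law_chain_mu => j i k x s z j0 iO kO xG sG zG.
  have [iG _ _ _] := localbaseP tP j0 iO; have [kG _ _ _] := localbaseP tP j0 kO.
  (* The matching splits into two conjugated base elements, each of degree at most [l]; hence
     [c = 2] for [dT]. *)
  rewrite (_ : (_ * z)%g = ((x^-1 * t k j * x)%g * ((x^-1 * t i j * x)^-1 * z))%g); last first.
    by rewrite !invMg !invgK !mulgA mulgK.
  apply: leq_trans (dT_mull tP _ _ _ _) _ => //.
  + by rewrite !groupM ?groupV.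
  + by rewrite pdegJ (localbase_pdeg tP).
  + by rewrite !(groupM, groupV).
  rewrite -[2%N]/(1 + 1)%N addnA leq_add2r; apply: dT_mullV => //.
    by rewrite !groupM ?groupV.
  by rewrite pdegJ (localbase_pdeg tP).
- move=> Gl muU.
  have [|||h1 h2] := @chain_ineqs R n G mu pmu (@dH n) l%:R; first by rewrite ltr0n.
  + exact: dHss.
  + apply: cell_chain_mu => // r s z rG rl sG zG.
    by apply: leq_trans (dH_mull _ _ _) _; rewrite leq_add2l pdegV.
  have [|||h3 h4] := @chain_ineqs R n G mu pmu (dT l G) 1; first exact: ltr01.
  + exact: dTss.
  + exact: (cell_chain_mu _ 1%N Gl muU dT_mullV).
  by [].
- move=> Gl muU; apply: exposable_ineq => //.
  rewrite (_ : mu = unif R (cell G true finset.set0 1%g)).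
    refine (cell_exposable R Gl true (group1 G) _).
    by rewrite -[n in leqRHS]card_ord max_card.
  by apply/funext => s; rewrite cell0 muU.
- move=> nG invG conjG.
  have muV s : mu s^-1%g = mu s.
    by have [/invG->//|sG] := boolP (s \in G); rewrite !mu_out ?groupV.
  have fixn (s : 'S_n) : fixge n s by move=> i; rewrite leqNgt ltn_ord.
  (* With [L = 2 * l - 1] one has [L - 1 = 2 * (l - 1)], whence the 8. *)
  rewrite (_ : 8 * _ + _ = shift_const R (2 * l - 1)); last first.
    rewrite /shift_const natrB; last by rewrite muln_gt0.
    by rewrite natrM; ring.
  apply: exposable_ineq => //.
  rewrite (_ : mu = fun s => partial_law t nuh n (1 * orient (~~ true) s * 1)%g); last first.
    by apply/funext => s; rewrite -muL mul1g mulg1 /= muV.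
  apply: (law_exposable tP nuhP) => //.
  (* At the top level conjugation invariance compensates [u] by its inverse; outside [G], normality
     makes both sides vanish. *)
  + move=> u _; exists u^-1%g => // s; rewrite -muL.
    have [sG|sG] := boolP (s \in G).
      by rewrite [RHS](conjG s u^-1%g sG) /permcomp invgK mulgA.
    rewrite !mu_out// -mulgA -/(conjg s u) memJ_norm//.
    by move: nG => /andP[_ /fintype.subsetP]; apply; rewrite inE.
  + by exists 1%g, 1%g; split=> // s; rewrite -muL mul1g mulg1 muV.
Qed.
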